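(* Let $m$ be a $12$-th power free integer such that the polynomial $f(x)=x^{12}-m$ is irreducible over $\mathbb{Q}$, let $\theta$ be a complex root of $f(x)$, and let $K=\mathbb{Q}(\theta)$ with ring of integers $O_K$. Let $p$ be a prime number and put $d=\gcd(v_p(m),12)$. Then the following hold. \begin{enumerate} \item If $p\mid m$ and $p\nmid v_p(m)$, then $$v_p([O_K:\mathbb{Z}[\theta]])=\frac{1}{2}\big[11(v_p(m)-1)+(d-1)\big],$$ and the set $$S=\left\{\frac{\theta^i}{p^{\lfloor iv_p(m)/12\rfloor}}\ :\ 0\le i\le 11\right\}$$ is a $p$-integral basis of $K$. \item If $p=3$ and $3\nmid m$, then $$v_3([O_K:\mathbb{Z}[\theta]])=\begin{cases}4, & \text{if } m^2\equiv 1 \pmod 9,\\ 0, & \text{if } m^2\not\equiv 1\pmod 9,\end{cases}$$ and a $3$-integral basis of $K$ is $$\Big\{1,\theta,\theta^2,\dots,\theta^7,\ \tfrac{h(\theta)}{3},\ \tfrac{\theta h(\theta)}{3},\ \tfrac{\theta^2 h(\theta)}{3},\ \tfrac{\theta^3 h(\theta)}{3}\Big\}\quad\text{if } m^2\equiv 1\pmod 9,$$ and $\{1,\theta,\theta^2,\dots,\theta^{11}\}$ if $m^2\not\equiv 1\pmod 9$, where $h(\theta)=\theta^8+m\theta^4+1$. \item If $p=2$ and $2\nmid m$, then $$v_2([O_K:\mathbb{Z}[\theta]])=\begin{cases}9, & \text{if } m\equiv 1\pmod 8,\\ 6, & \text{if } m\equiv 5\pmod 8,\\ 0, & \text{if }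 m\equiv 3\pmod 4,\end{cases}$$ and a $2$-integral basis of $K$ is \begin{itemize} \item $\Big\{1,\theta,\theta^2,\theta^3,\theta^4,\theta^5,\frac{\theta^6-1}{2},\frac{\theta(\theta^6-1)}{2},\frac{\theta^2(\theta^6-1)}{2},\frac{g(\theta)}{2^2},\frac{\theta g(\theta)}{2^2},\frac{\theta^2 g(\theta)}{2^2}\Big\}$ if $m\equiv 1\pmod 8$, where $g(\theta)=\theta^9+\theta^6+\theta^3+1$; \item $\Big\{1,\theta,\theta^2,\theta^3,\theta^4,\theta^5,\frac{\theta^6-1}{2},\frac{\theta(\theta^6-1)}{2},\frac{\theta^2(\theta^6-1)}{2},\frac{\theta^3(\theta^6-1)}{2},\frac{\theta^4(\theta^6-1)}{2},\frac{\theta^5(\theta^6-1)}{2}\Big\}$ if $m\equiv 5\pmod 8$; \item $\{1,\theta,\theta^2,\dots,\theta^{11}\}$ if $m\equiv 3\pmod 4$. \end{itemize} \item If $p\nmid 12m$, then $v_p([O_K:\mathbb{Z}[\theta]])=0$ and $\{1,\theta,\theta^2,\dots,\theta^{11}\}$ is a $p$-integral basis of $K$. \end{enumerate}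
   Context: For a prime $p$ and a nonzero integer $t$, $v_p(t)$ denotes the exponent of the highest power of $p$ dividing $t$. $[O_K:\mathbb{Z}[\theta]]$ is the index of the additive subgroup $\mathbb{Z}[\theta]$ in $O_K$. Let $\mathbb{Z}_{(p)}$ be the localization of $\mathbb{Z}$ at the prime ideal $p\mathbb{Z}$ and $R_{(p)}$ the integral closure of $\mathbb{Z}_{(p)}$ in $K$; it is a free $\mathbb{Z}_{(p)}$-module of rank $12$, and a $p$-integral basis of $K$ is a $\mathbb{Z}_{(p)}$-basis of $R_{(p)}$. *)

(* Defs.v *)
From mathcomp Require Import all_boot all_order all_algebra all_field.
Set Implicit Arguments. Unset Strict Implicit. Unset Printing Implicit Defensive.
Import Order.TTheory GRing.Theory Num.Theory.
Local Open Scope ring_scope.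

Definition twelfth_power_free (m : int) : Prop :=
  forall p : nat, prime p -> ~~ (p ^ 12 %| `|m|)%N.

Definition fpoly (m : int) : {poly rat} := 'X^12 - (m%:~R)%:P.

Definition inK (theta : algC) (x : algC) : Prop :=
  exists q : {poly rat}, x = (map_poly ratr q).[theta].

Definition inOK (theta : algC) (x : algC) : Prop := inK theta x /\ x \in Aint.

Definition inZtheta (theta : algC) (x : algC) : Prop :=
  exists q : {poly int}, x = (map_poly intr q).[theta].

(* n is the index of the additive subgroup B in A: there is a complete
   system of n pairwise inequivalent representatives of A modulo B. *)
Definition is_index (A B : algC -> Prop) (n : nat) : Prop :=
  exists r : 'I_n -> algC,
    (forall i, A (r i)) /\
    (forall i j, B (r i - r j) -> i = j) /\
    (forall a, A a -> exists i, B (a - r i)).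

Definition inZloc (p : nat) (q : rat) : bool := coprime p `|denq q|.

Definition integral_over_Zloc (p : nat) (x : algC) : Prop :=
  exists P : {poly rat},
    [/\ P \is monic, (forall i, inZloc p P`_i) & root (map_poly ratr P) x].

Definition inRp (p : nat) (theta : algC) (x : algC) : Prop :=
  inK theta x /\ integral_over_Zloc p x.

Definition p_integral_basis (p : nat) (theta : algC) (b : 'I_12 -> algC) : Prop :=
  [/\ (forall i, inRp p theta (b i)),
      (forall x, inRp p theta x ->
         exists c : 'I_12 -> rat, (forall i, inZloc p (c i)) /\
           x = \sum_(i < 12) ratr (c i) * b i) &
      (forall c : 'I_12 -> rat, (forall i, inZloc p (c i)) ->
         \sum_(i < 12) ratr (c i) * b i = 0 -> forall i, c i = 0)].

Definition vp_index (p : nat) (theta : algC) (k : nat) : Prop :=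
  exists n : nat, is_index (inOK theta) (inZtheta theta) n /\ logn p n = k.

Definition power_basis (theta : algC) : 'I_12 -> algC := fun i => theta ^+ i.

Definition basis_case1 (p v : nat) (theta : algC) : 'I_12 -> algC :=
  fun i => theta ^+ i / (p%:R ^+ ((i * v) %/ 12)%N).

Definition h_theta (m : int) (theta : algC) : algC :=
  theta ^+ 8 + m%:~R * theta ^+ 4 + 1.

Definition basis_p3 (m : int) (theta : algC) : 'I_12 -> algC :=
  fun i => if (i < 8)%N then theta ^+ i
           else theta ^+ (i - 8) * h_theta m theta / 3.

Definition g_theta (theta : algC) : algC :=
  theta ^+ 9 + theta ^+ 6 + theta ^+ 3 + 1.

Definition basis_p2_1mod8 (theta : algC) : 'I_12 -> algC :=
  fun i => if (i < 6)%N then theta ^+ i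
           else if (i < 9)%N then theta ^+ (i - 6) * (theta ^+ 6 - 1) / 2
           else theta ^+ (i - 9) * g_theta theta / 2 ^+ 2.

Definition basis_p2_5mod8 (theta : algC) : 'I_12 -> algC :=
  fun i => if (i < 6)%N then theta ^+ i
           else theta ^+ (i - 6) * (theta ^+ 6 - 1) / 2.

(* Main.v *)
(* Write x = sum c_i theta^i.  Averaging the conjugates of x under
   theta |-> zeta theta, twisted by characters, shows that s times the partial
   sum over the i in one class mod s is integral whenever x is, for every s
   dividing 12.  With s = 12 this bounds the denominators of the c_i, which
   settles the primes not dividing 12 m.  If p divides m but not v_p(m), take for s
   the p'-part of 12: within a class mod s the terms c_i theta^i have
   pairwise distinct valuations, so each of them is integral.  If p = 3 (resp.
   p = 2) does not divide m, take s = 4 (resp. s = 3): this reduces the question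
   to the pure cubic field of theta^4 (resp. the pure quartic field of
   theta^3), where applying the same bounds to the squares of integral elements
   leaves finitely many residue classes of coefficients to examine.
   For the index, choose elements of O_K of degree t < 12 in theta with leading
   coefficient 1/d_t, d_t maximal; then [O_K : Z[theta]] is the product of the
   d_t, and v_p(d_t) is read off any triangular p-integral basis. *)

Require Import Defs.
From HB Require Import structures.
From mathcomp Require Import all_boot all_order all_algebra all_field.
From mathcomp Require Import boolp ring lra zify.
Import Order.TTheory GRing.Theory Num.Theory.
Local Open Scope ring_scope.
Set Implicit Arguments. Unset Strict Implicit. Unset Printing Implicit Defensive.

(** Projecting onto a class mod s costs a factor s, which is harmless when s is prime to p. This
    dictates the p'-part of 12 in general, hence s = 4 at 3 and s = 3 at 2. The averaging bound in
    the remaining cubic or quartic field still allows the denominators 3 or 4. Squaring sharpens it: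
    the square is again integral and obeys the same bound, although its coefficients have a priori
    denominators 9 or 16. The few classes that survive without belonging to the proposed basis are
    excluded one by one, by an integral expression in them that violates a bound in a cubic or
    quadratic field. In the ramified case no place of K above p is ever chosen. A monomial c theta^i
    is a 12-th root of a rational number, so its integrality is read off that rational number, and
    the radical of p stands in for a maximal ideal. *)

Local Notation ev q theta := (map_poly ratr q).[theta].
Local Notation pure_irr n m := (irreducible_poly ('X^n - (m%:~R)%:P : {poly rat})).

(** * Integrality over the localization at p *)

(* For [p] prime these are the elements integral over Z_(p); for [p = 0] the
   only admissible [n] is 1, so that [plocal 0] is [Aint]. *)
Definition plocal (p : nat) : {pred algC} :=
  fun x => `[< exists2 n : nat, coprime p n & n%:R * x \in Aint >].

Lemma plocalP (p : nat) (x : algC) :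
  reflect (exists2 n : nat, coprime p n & n%:R * x \in Aint) (x \in plocal p).
Proof. exact: asboolP. Qed.

Lemma Aint_plocal (p : nat) (x : algC) : x \in Aint -> x \in plocal p.
Proof. by move=> xA; apply/plocalP; exists 1%N; rewrite ?coprimen1 ?mul1r. Qed.

Lemma plocal0 (x : algC) : (x \in plocal 0) = (x \in Aint).
Proof.
apply/idP/idP => [/plocalP[n]|]; last exact: Aint_plocal.
by rewrite /coprime gcd0n => /eqP-> ; rewrite mul1r.
Qed.

Fact plocal_subring (p : nat) : subring_closed (plocal p).
Proof.
split.
- exact/Aint_plocal/Aint1.
- move=> x y /plocalP[a pa xA] /plocalP[b pb yA]; apply/plocalP.
  exists (a * b)%N; first by rewrite coprimeMr pa.
  have -> : (a * b)%:R * (x - y) = b%:R * (a%:R * x) - a%:R * (b%:R * y).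
    by rewrite natrM; ring.
  by apply: rpredB; apply: rpredM; rewrite ?rpred_nat.
- move=> x y /plocalP[a pa xA] /plocalP[b pb yA]; apply/plocalP.
  exists (a * b)%N; first by rewrite coprimeMr pa.
  by rewrite natrM mulrACA rpredM.
Qed.
HB.instance Definition _ p := GRing.isSubringClosed.Build algC (plocal p) (plocal_subring p).

Lemma plocal_cancel (p n : nat) (x : algC) :
  coprime p n -> n%:R * x \in plocal p -> x \in plocal p.
Proof.
move=> pn /plocalP[a pa xA]; apply/plocalP; exists (a * n)%N.
  by rewrite coprimeMr pa.
by rewrite natrM -mulrA.
Qed.

(** A rational algebraic integer is an integer, so n q = k with n prime to p forces the reduced
    denominator of q to divide n. *)
Lemma plocal_rat (p : nat) (q : rat) : (ratr q \in plocal p) = inZloc p q.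
Proof.
apply/plocalP/idP => [[n pn]|pq]; last first.
  exists `|denq q|%N => //.
  have -> : `|denq q|%:R * ratr q = ratr (numq q)%:~R :> algC.
    by rewrite -ratr_nat -rmorphM /= natr_absz ger0_norm ?denq_ge0 // numqE mulrC.
  by rewrite ratr_int Aint_int.
rewrite -ratr_nat -rmorphM /= => nqA.
have /intrP[k kE] : (ratr (n%:R * q) : algC) \in Num.int.
  by apply: Cint_rat_Aint => //; apply: Crat_rat.
have {kE} kE : n%:R * q = k%:~R.
  by apply: (fmorph_inj (@ratr algC)); rewrite /= kE ratr_int.
rewrite /inZloc; apply: (coprime_dvdr _ pn).
have e : (n%:Z * numq q = k * denq q)%R.
  by apply: (@intr_inj rat); rewrite !rmorphM /= numqE mulrA -kE.
have : (`|denq q| %| `|(n%:Z * numq q)%R|)%N by rewrite e abszM dvdn_mull.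
by rewrite abszM /= Gauss_dvdl // coprime_sym coprime_num_den.
Qed.

Lemma plocal_int (p : nat) (k : int) : k%:~R \in plocal p.
Proof. exact/Aint_plocal/Aint_int. Qed.

Lemma natr_plocal (p n : nat) : n%:R \in plocal p.
Proof. exact: (plocal_int p n). Qed.

(* Clear denominators: if [N] does so for [P] monic of degree [d], then
   [N x] is a root of [N^d P(X / N)]. *)
Lemma integral_plocal (p : nat) (x : algC) : prime p ->
  integral_over_Zloc p x <-> x \in plocal p.
Proof.
move=> p_pr; split=> [[P [Pmon Pint Px]] | /plocalP[n pn nxA]].
- pose N := (\prod_(i < size P) `|denq P`_i|)%N.
  have pN : coprime p N.
    rewrite /N; apply: (big_ind (fun n => coprime p n)) => [|a b pa pb|i _].
    - exact: coprimen1.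
    - by rewrite coprimeMr pa.
    - exact: Pint.
  have NP i : exists k : int, N%:R * P`_i = k%:~R.
    have [iP|iP] := ltnP i (size P); last first.
      by exists 0; rewrite nth_default ?mulr0.
    rewrite /N (bigD1 (Ordinal iP)) //= natrM; set M := (\prod_(_ < _ | _) _)%N.
    exists (M%:Z * numq P`_i); rewrite rmorphM /= numqE -pmulrn.
    by rewrite natr_absz ger0_norm ?denq_ge0 //; ring.
  apply/plocalP; exists N => //.
  have N0 : (N%:R : algC) != 0.
    rewrite pnatr_eq0 /N; apply/eqP => /eqP; rewrite -leqn0 leqNgt prodn_gt0 // => i.
    by rewrite absz_gt0 denq_neq0.
  pose d := (size P).-1.
  have Ps : size P = d.+1 by rewrite prednK // size_poly_gt0 monic_neq0.
  pose Q : {poly algC} := \poly_(i < d.+1) (ratr P`_i * N%:R ^+ (d - i)).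
  have Qd : Q`_d = 1.
    rewrite coef_poly ltnSn subnn expr0 mulr1.
    by have /monicP := Pmon; rewrite lead_coefE -/d => ->; rewrite rmorph1.
  have Qs : size Q = d.+1.
    apply/eqP; rewrite eqn_leq size_poly /=.
    by rewrite ltnNge; apply/negP => /leq_sizeP/(_ d (leqnn d))/eqP; rewrite Qd oner_eq0.
  apply: (@root_monic_Aint Q).
  + rewrite /root horner_poly; apply/eqP.
    have -> : \sum_(i < d.+1) ratr P`_i * N%:R ^+ (d - i) * (N%:R * x) ^+ i
        = N%:R ^+ d * (map_poly ratr P).[x].
      rewrite horner_coef size_map_poly Ps mulr_sumr; apply: eq_bigr => i _.
      rewrite coef_map /= exprMn.
      have -> : N%:R ^+ d = N%:R ^+ (d - i) * N%:R ^+ i :> algC.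
        by rewrite -exprD subnK // leq_ord.
      ring.
    by rewrite (rootP Px) mulr0.
  + by rewrite monicE lead_coefE Qs Qd.
  + apply/(all_nthP 0) => i; rewrite Qs ltnS => id.
    rewrite coef_poly ltnS id.
    have [id'|id'] := ltnP i d.
      have -> : (d - i = (d - i.+1).+1)%N by lia.
      rewrite exprS mulrA [_ * N%:R]mulrC -ratr_nat -rmorphM /=.
      have [k ->] := NP i.
      by rewrite ratr_int rpredM ?rpredX ?rpred_int ?ratr_nat ?rpred_nat.
    have -> : i = d by apply/eqP; rewrite eqn_leq id.
    have /monicP := Pmon; rewrite lead_coefE -/d => ->.
    by rewrite rmorph1 subnn mulr1; apply: rpred1.
- have n0 : (n%:R : rat) != 0.
    apply: contraTneq pn => /eqP; rewrite pnatr_eq0 => /eqP->.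
    by rewrite /coprime gcdn0 gtn_eqF ?prime_gt1.
  have [R [RE Rmon] _] := minCpolyP (n%:R * x).
  pose d := (size R).-1.
  have Rs : size R = d.+1 by rewrite prednK // size_poly_gt0 monic_neq0.
  (* For the converse, the minimal polynomial R of n x has integer coefficients, and n^(-d) R(n X)
     is monic with root x. Its i-th coefficient has a denominator dividing n^(d - i). *)
  pose P : {poly rat} := n%:R ^- d *: (R \Po (n%:R *: 'X)).
  have Pi i : P`_i = R`_i * n%:R ^+ i / n%:R ^+ d.
    rewrite coefZ comp_polyE coef_sum mulrC; congr (_ / _).
    under eq_bigr do rewrite exprZn coefZ coefZ coefXn.
    have [iR|iR] := ltnP i (size R); last first.
      rewrite nth_default // mul0r big1 // => j _.
      by rewrite gtn_eqF ?mulr0 // (leq_trans (ltn_ord j)).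
    rewrite (bigD1 (Ordinal iR)) //= eqxx mulr1 big1 ?addr0 // => j ji.
    by rewrite eq_sym (negPf (ji : val j != i)) !mulr0.
  have RZ i : exists k : int, R`_i = k%:~R.
    have /polyOverP/(_ i) : minCpoly (n%:R * x) \is a polyOver Num.int := nxA.
    rewrite RE coef_map /= => /intrP[k kE]; exists k.
    by apply: (fmorph_inj (@ratr algC)); rewrite /= kE ratr_int.
  have Rd : R`_d = 1 by have /monicP := Rmon; rewrite lead_coefE.
  have Pd : P`_d = 1 by rewrite Pi Rd mul1r divff // expf_neq0.
  have Ps : size P = d.+1.
    apply/eqP; rewrite eqn_leq ltnNge; apply/andP; split.
      apply/leq_sizeP => i di; rewrite Pi nth_default ?mul0r //.
      by rewrite Rs.
    by apply/negP => /leq_sizeP/(_ d (leqnn d))/eqP; rewrite Pd oner_eq0.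
  exists P; split.
  + by rewrite monicE lead_coefE Ps Pd.
  + move=> i; rewrite -plocal_rat; have [id|id] := leqP i d; last first.
      by rewrite nth_default ?Ps // rmorph0 rpred0.
    apply/plocalP; exists (n ^ (d - i))%N; first by rewrite coprimeXr.
    have [k kE] := RZ i.
    have -> : (n ^ (d - i))%:R * ratr P`_i = k%:~R :> algC; last exact: Aint_int.
    rewrite -ratr_nat -rmorphM /= Pi kE natrX.
    rewrite -[in n%:R ^+ d](subnK id) exprD.
    rewrite -[RHS]ratr_int; congr ratr.
    by field; rewrite ?expf_neq0.
  + rewrite /root map_polyZ hornerZ map_comp_poly horner_comp map_polyZ hornerZ.
    rewrite map_polyX hornerX /= ratr_nat -RE.
    by rewrite (rootP (root_minCpoly _)) mulr0.
Qed.
(** * Conjugates in a pure field *)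

Section PureField.
Variables (n : nat) (m : int) (theta : algC).
Hypothesis n_gt0 : (0 < n)%N.
Hypothesis irr : irreducible_poly ('X^n - (m%:~R)%:P : {poly rat}).
Hypothesis thetaE : theta ^+ n = m%:~R.

Lemma ev_pure (t : algC) : ev ('X^n - (m%:~R)%:P) t = t ^+ n - m%:~R.
Proof. by rewrite rmorphB /= map_polyXn map_polyC /= !hornerE ratr_int. Qed.

Lemma pure_dvd (q : {poly rat}) :
  ev q theta = 0 -> ('X^n - (m%:~R)%:P) %| q.
Proof.
move=> q0; apply: contraT; rewrite -irreducible_poly_coprime //.
rewrite -(coprimep_map (@ratr algC)) => /coprimep_root cop.
have /cop : root (map_poly ratr ('X^n - (m%:~R)%:P)) theta.
  by rewrite /root ev_pure thetaE subrr.
by rewrite q0 eqxx.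
Qed.

Lemma pure_conj (q : {poly rat}) (t : algC) :
  ev q theta = 0 -> t ^+ n = m%:~R -> ev q t = 0.
Proof.
move=> /pure_dvd/dvdpP[g ->] tE.
by rewrite rmorphM hornerM ev_pure tE subrr mulr0.
Qed.

Lemma pure_free (q : {poly rat}) : (size q <= n)%N -> ev q theta = 0 -> q = 0.
Proof.
move=> qn /pure_dvd qd; apply: contraTeq qd => q0.
by apply: contraL qn => /(dvdp_leq q0); rewrite size_XnsubC // ltnNge.
Qed.

(** The minimal polynomial of q(theta), composed with q, vanishes at theta, hence is divisible by
    X^n - m and vanishes at every n-th root t of m. *)
Lemma pure_conj_Aint (q : {poly rat}) (t : algC) :
  ev q theta \in Aint -> t ^+ n = m%:~R -> ev q t \in Aint.
Proof.
move=> qA tE; have [R [RE Rmon] _] := minCpolyP (ev q theta).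
apply: (@root_monic_Aint (minCpoly (ev q theta))) => //; last exact: minCpoly_monic.
rewrite RE /root -horner_comp -map_comp_poly pure_conj //.
by rewrite map_comp_poly horner_comp -RE; apply/rootP/root_minCpoly.
Qed.

Lemma pure_conj_plocal (p : nat) (q : {poly rat}) (t : algC) :
  ev q theta \in plocal p -> t ^+ n = m%:~R -> ev q t \in plocal p.
Proof.
move=> /plocalP[k pk kA] tE; apply/plocalP; exists k => //.
have E (s : algC) : k%:R * ev q s = ev (k%:R *: q) s.
  by rewrite map_polyZ hornerZ /= ratr_nat.
by rewrite E pure_conj_Aint // -E.
Qed.

Lemma ev_sum (c : nat -> rat) (k : nat) (t : algC) :
  ev (\poly_(i < k) c i) t = \sum_(i < k) ratr (c i) * t ^+ i.
Proof.
rewrite (@horner_coef_wide _ k) ?size_map_poly ?size_poly //.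
by apply: eq_bigr => i _; rewrite coef_map coef_poly ltn_ord.
Qed.

Lemma sum_prim_root (s : nat) (z : algC) (a : nat) : s.-primitive_root z ->
  \sum_(k < s) z ^+ (a * k) = if (s %| a)%N then s%:R else 0.
Proof.
move=> zP; under eq_bigr do rewrite exprM.
case: ifPn => [|sa].
  rewrite (prim_order_dvd zP) => /eqP ->.
  by under eq_bigr do rewrite expr1n; rewrite sumr_const card_ord.
apply: (mulfI (_ : z ^+ a - 1 != 0)).
  by rewrite subr_eq0 -(prim_order_dvd zP).
by rewrite -subrX1 -exprM mulnC exprM (prim_expr_order zP) expr1n subrr mulr0.
Qed.

(* The average of the conjugates of [x] over [theta |-> z ^ k theta], twisted
   by [z ^ (- j k)], with [z] a primitive [s]-th root of unity. *)
Lemma plocal_component (p s j : nat) (c : nat -> rat) :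
  (s %| n)%N -> (j < s)%N ->
  \sum_(i < n) ratr (c i) * theta ^+ i \in plocal p ->
  s%:R * (\sum_(i < n | (i %% s == j)%N) ratr (c i) * theta ^+ i) \in plocal p.
Proof.
move=> sn js; rewrite -ev_sum => xA.
have [z zP] := C_prim_root_exists (leq_ltn_trans (leq0n j) js).
have zA : z \in Aint by apply: Aint_prim_root zP.
have -> : s%:R * (\sum_(i < n | (i %% s == j)%N) ratr (c i) * theta ^+ i) =
  \sum_(k < s) z ^+ ((s - j) * k) * ev (\poly_(i < n) c i) (z ^+ k * theta).
  under [RHS]eq_bigr => k _ do rewrite ev_sum mulr_sumr.
  rewrite exchange_big /= mulr_sumr big_mkcond /=; apply: eq_bigr => i _.
  transitivity ((\sum_(k < s) z ^+ ((s - j + i) * k)) * (ratr (c i) * theta ^+ i)).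
    rewrite (sum_prim_root _ zP).
    have -> : (s %| s - j + i)%N = (i %% s == j)%N.
      rewrite -{2}(modn_small js) -(eqn_modDl (s - j)) subnK ?(ltnW js) //.
      by rewrite modnn.
    by case: ifP; rewrite ?mul0r.
  rewrite mulr_suml; apply: eq_bigr => k _.
  by rewrite exprMn -exprM mulnDl exprD (mulnC i k); ring.
apply: rpred_sum => k _; apply: rpredM.
  by apply: rpredX; apply: Aint_plocal.
apply: pure_conj_plocal => //.
rewrite exprMn thetaE -exprM mulnC exprM; have /dvdnP[l ->] := sn.
by rewrite mulnC exprM (prim_expr_order zP) !expr1n mul1r.
Qed.

Lemma theta_Aint : theta \in Aint.
Proof.
apply: (@root_monic_Aint ('X^n - (m%:~R)%:P)).
- by rewrite /root !hornerE thetaE subrr.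
- exact: monicXnsubC.
- apply/(all_nthP 0) => i _; rewrite coefB coefXn coefC.
  case: (i == 0)%N; rewrite ?subr0; last exact: rpred_nat.
  by apply: rpredB; [exact: rpred_nat | exact: rpred_int].
Qed.

(** For s = n the class of i contains i alone. Multiplying the isolated term by theta^(n - i)
    replaces theta^i by m. *)
Lemma plocal_coef (p : nat) (c : nat -> rat) (i : nat) : (i < n)%N ->
  \sum_(i < n) ratr (c i) * theta ^+ i \in plocal p ->
  ratr (n%:R * m%:~R * c i) \in plocal p.
Proof.
move=> iN /(@plocal_component p n i c (dvdnn n) iN).
rewrite (big_pred1 (Ordinal iN)) => [xA|k]; last by rewrite /= modn_small.
have -> : ratr (n%:R * m%:~R * c i) =
    theta ^+ (n - i) * (n%:R * (ratr (c i) * theta ^+ i)).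
  rewrite !rmorphM /= ratr_nat ratr_int -thetaE.
  by rewrite -[in theta ^+ n](subnK (ltnW iN)) exprD; ring.
by rewrite rpredM // rpredX // Aint_plocal // theta_Aint.
Qed.

(** Since theta theta^(n - 1) = m is prime to p, theta is a unit in the ring of p-integral
    elements. *)
Lemma pure_unit (p : nat) (x : algC) (k : nat) :
  coprime p `|m| -> theta ^+ k * x \in plocal p -> x \in plocal p.
Proof.
move=> pm; elim: k => [|k IH]; first by rewrite mul1r.
rewrite exprS -mulrA => xA; apply: IH; apply: (plocal_cancel pm).
set y := theta ^+ k * x in xA *.
have -> : `|m|%:R * y = (sgz m)%:~R * (theta ^+ n.-1 * (theta * y)).
  rewrite (mulrA _ theta) -exprSr prednK // thetaE [RHS]mulrA -intrM.
  by rewrite natr_absz normrEsg -sgrz.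
by rewrite rpredM ?plocal_int // rpredM // rpredX // Aint_plocal // theta_Aint.
Qed.
End PureField.

(** * The index of a triangular lattice *)

Lemma is_index_card (T : finType) (A B : algC -> Prop) (r : T -> algC) :
  (forall i, A (r i)) -> (forall i j, B (r i - r j) -> i = j) ->
  (forall a, A a -> exists i, B (a - r i)) -> is_index A B #|T|.
Proof.
move=> rA rB rS; exists (r \o enum_val); split=> [i|]; first exact: rA.
split=> [i j /rB/enum_val_inj //|a /rS[i ai]].
by exists (enum_rank i); rewrite /= enum_rankK.
Qed.

Lemma is_index_ext (A A' B B' : algC -> Prop) (n : nat) :
  (forall x, A x <-> A' x) -> (forall x, B x <-> B' x) ->
  is_index A B n -> is_index A' B' n.
Proof.
move=> AA BB [r [rA [rB rS]]]; exists r; split=> [i|]; first exact/AA.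
split=> [i j /BB/rB //|a /AA/rS[i ai]]; by exists i; apply/BB.
Qed.

(** L is a group between Z and (1/D) Z, hence cyclic: by Euclidean division it is generated by k / D
    with k > 0 minimal. As 1 lies in L, k divides D, so the generator is the inverse of an
    integer. *)
Lemma fractional_ideal_gen (L : rat -> Prop) (D : nat) :
  (forall x y (z : int), L x -> L y -> L (x - z%:~R * y)) -> L 1 ->
  (0 < D)%N -> (forall x, L x -> D%:R * x \is a Num.int) ->
  exists d : nat, [/\ (0 < d)%N, L d%:R^-1 & forall x, L x -> d%:R * x \is a Num.int].
Proof.
move=> LB L1 D0 LD.
have D0' : (D%:R : rat) != 0 by rewrite pnatr_eq0 -lt0n.
have exk : exists k, (0 < k)%N && `[< L (k%:R / D%:R) >].
  by exists D; rewrite D0; apply/asboolP; rewrite divff.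
case: (ex_minnP exk) => k /andP[k0 /asboolP Lk] kmin.
have k0' : (k%:R : rat) != 0 by rewrite pnatr_eq0 -lt0n.
have kdvd (x : rat) : L x -> exists l : int, D%:R * x = k%:R * l%:~R.
  move=> Lx; have /intrP[z zE] := LD _ Lx; exists (z %/ k)%Z.
  have := LB _ _ (z %/ k)%Z Lx Lk.
  have k0Z : (k : int) != 0 by lia.
  have -> : x - (z %/ k)%Z%:~R * (k%:R / D%:R) = `|(z %% k)%Z|%:R / D%:R.
    rewrite natr_absz ger0_norm ?modz_ge0 // /modz rmorphB rmorphM /= -zE.
    by rewrite -pmulrn; field.
  move=> Lr; have r0 : (z %% k)%Z = 0.
    have k0z : (0 : int) < k by lia.
    have := ltz_pmod z k0z; have := modz_ge0 z k0Z.
    move: (z %% k)%Z Lr => r Lr r_ge0 rk.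
    have [|r0] := posnP `|r|; first lia.
    have : (k <= `|r|)%N by apply: kmin; rewrite r0; apply/asboolP.
    by lia.
  by rewrite zE {1}(divz_eq z k) r0 addr0 rmorphM /= -pmulrn mulrC.
have [l] := kdvd _ L1; rewrite mulr1 => lE.
have l0 : 0 < l.
  by rewrite -(ltr0z rat) -(pmulr_rgt0 _ (_ : 0 < k%:R)) -?lE ltr0n.
have lE' : `|l|%:R = l%:~R :> rat by rewrite natr_absz gtr0_norm.
have lN0 : (l%:~R : rat) != 0 by rewrite intr_eq0 gt_eqF.
exists `|l|%N; split=> [||x /kdvd[y yE]].
- by rewrite absz_gt0 gt_eqF.
- suff -> : `|l|%:R^-1 = k%:R / D%:R :> rat by [].
  by rewrite lE' lE; field; rewrite k0' lN0.
- apply/intrP; exists y; apply: (mulfI k0').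
  by rewrite lE' mulrA -lE.
Qed.

(** The two memberships bound v_p(d) from both sides: p^e / d being p-integral gives v_p(d) <= e,
    and d n / p^e being an integer with n prime to p gives e <= v_p(d). *)
Lemma logn_eq_denominator (p d e n : nat) : prime p -> (0 < d)%N ->
  inZloc p (p%:R ^+ e / d%:R) -> coprime p n ->
  d%:R * (n%:R / p%:R ^+ e) \is a @Num.int rat -> logn p d = e.
Proof.
move=> p_pr d0; rewrite -plocal_rat => /plocalP[k pk].
have d0' : (d%:R : rat) != 0 by rewrite pnatr_eq0 -lt0n.
have p0' : (p%:R : rat) != 0 by rewrite pnatr_eq0 -lt0n prime_gt0.
rewrite -(ratr_nat algC k) -rmorphM /= => kA pn /intrP[z zE].
have /intrP[y] : (ratr (k%:R * (p%:R ^+ e / d%:R)) : algC) \in Num.int.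
  by apply: Cint_rat_Aint => //; apply: Crat_rat.
rewrite -ratr_int => /(fmorph_inj (@ratr algC)) yE.
have dk : (d %| k * p ^ e)%N.
  have E : (k * p ^ e)%:Z = y * d.
    apply: (@intr_inj rat); rewrite -pmulrn natrM natrX rmorphM /= -yE -pmulrn.
    by field.
  by apply/dvdnP; exists `|y|%N; lia.
have pd : (p ^ e %| d * n)%N.
  have E : (d * n)%:Z = z * (p ^ e)%:Z.
    apply: (@intr_inj rat); rewrite -pmulrn natrM rmorphM /= -zE -pmulrn natrX.
    by field; rewrite expf_neq0.
  by apply/dvdnP; exists `|z|%N; lia.
have k0 : (0 < k)%N.
  by case: k pk {kA yE dk} => //; rewrite /coprime gcdn0 => /eqP p1; rewrite p1 in p_pr.
apply/eqP; rewrite eqn_leq; apply/andP; split.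
  have -> : e = logn p (k * p ^ e).
    by rewrite lognM ?expn_gt0 ?(prime_gt0 p_pr) // logn_coprime // pfactorK.
  by apply: dvdn_leq_log => //; rewrite muln_gt0 k0 expn_gt0 prime_gt0.
by rewrite -pfactor_dvdn // -(Gauss_dvdl _ (_ : coprime (p ^ e) n)) // coprimeXl.
Qed.

Section Lattice.
Variables (theta : algC) (n : nat).
Hypothesis theta_int : theta \in Aint.
Hypothesis theta_free :
  forall q : {poly rat}, (size q <= n)%N -> ev q theta = 0 -> q = 0.

Lemma ev_inj (q r : {poly rat}) : (size q <= n)%N -> (size r <= n)%N ->
  ev q theta = ev r theta -> q = r.
Proof.
move=> qn rn qr; apply/eqP; rewrite -subr_eq0; apply/eqP/theta_free.
  by rewrite (leq_trans (size_polyD _ _)) // size_polyN geq_max qn.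
by rewrite rmorphB hornerD hornerN qr subrr.
Qed.

Lemma ev_intr (q : {poly int}) : (map_poly intr q).[theta] = ev (map_poly intr q) theta.
Proof.
by rewrite -map_poly_comp; congr horner; apply: eq_map_poly => i /=; rewrite ratr_int.
Qed.

(** O_K and Z[theta] are filtered by degree in theta, so that the index can be computed one degree
    at a time. *)
Definition Aint_below (t : nat) (x : algC) : Prop :=
  exists q : {poly rat}, [/\ (size q <= t)%N, x = ev q theta & x \in Aint].
Definition Ztheta_below (t : nat) (x : algC) : Prop :=
  exists2 q : {poly int}, (size q <= t)%N & x = (map_poly intr q).[theta].

Lemma size_subl (R : nzRingType) (q r : {poly R}) (t : nat) :
  (size q <= t)%N -> (size r <= t)%N -> (size (q - r)%R <= t)%N.
Proof. by move=> qt rt; rewrite (leq_trans (size_polyD _ _)) // size_polyN geq_max qt. Qed.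

Lemma size_lower (R : nzRingType) (q : {poly R}) (t : nat) :
  (size q <= t.+1)%N -> q`_t = 0 -> (size q <= t)%N.
Proof.
move=> qt q0; apply/leq_sizeP => i; rewrite leq_eqVlt => /predU1P[<- //|ti].
by rewrite nth_default // (leq_trans qt).
Qed.

(** The coefficient of degree t maps the integral elements onto (1/d) Z and those of Z[theta] onto
    Z, with the previous filtration steps as kernels. So each old representative r gives the d
    representatives r + b w with b < d. *)
Lemma index_step (t N d : nat) (w : {poly rat}) : (t < n)%N -> (0 < d)%N ->
  (size w <= t.+1)%N -> w`_t = d%:R^-1 -> ev w theta \in Aint ->
  (forall q : {poly rat}, (size q <= t.+1)%N -> ev q theta \in Aint ->
     d%:R * q`_t \is a Num.int) ->
  is_index (Aint_below t) (Ztheta_below t) N ->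
  is_index (Aint_below t.+1) (Ztheta_below t.+1) (N * d).
Proof.
move=> tn d0 ws wt wA wmax [r [rA [rB rS]]].
have d0' : (d%:R : rat) != 0 by rewrite pnatr_eq0 -lt0n.
have -> : (N * d = #|{: 'I_N * 'I_d}|)%N by rewrite card_prod !card_ord.
apply: (@is_index_card ('I_N * 'I_d)%type _ _ (fun ab => r ab.1 + ab.2%:R * ev w theta)).
- case=> a b /=; have [q [qs -> qA]] := rA a; exists (q + b%:R *: w); split.
  + rewrite (leq_trans (size_polyD _ _)) // geq_max (leq_trans qs) //=.
    exact: leq_trans (size_scale_leq _ _) ws.
  + by rewrite rmorphD /= map_polyZ /= hornerD hornerZ ratr_nat.
  + by apply: rpredD => //; apply: rpredM => //; apply: rpred_nat.
- case=> a b [a' b'] /= [q qs qE].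
  have [x [xs xE _]] := rA a; have [x' [xs' xE' _]] := rA a'.
  have E : map_poly intr q = x - x' + (b%:R - b'%:R) *: w :> {poly rat}.
    apply: ev_inj.
    - exact: leq_trans (size_poly _ _) (leq_trans qs tn).
    - rewrite (leq_trans (size_polyD _ _)) // geq_max.
      rewrite (leq_trans (size_subl xs xs') (ltnW tn)) /=.
      exact: leq_trans (size_scale_leq _ _) (leq_trans ws tn).
    - rewrite -ev_intr -qE !rmorphD rmorphN /= map_polyZ /= !hornerE.
      by rewrite -xE -xE' rmorphB /= !ratr_nat; ring.
  have bb : b = b'.
    have /(congr1 (fun s : {poly rat} => s`_t)) := E.
    have xt : x`_t = 0 by rewrite nth_default.
    have xt' : x'`_t = 0 by rewrite nth_default.
    rewrite coef_map !coefD coefN coefZ xt xt' wt subrr add0r /= => qt.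
    have {}qt : b%:Z - b'%:Z = q`_t * d%:Z.
      by apply: (@intr_inj rat); rewrite rmorphB rmorphM /= qt -!pmulrn divfK.
    apply: val_inj => /=; have := ltn_ord b; have := ltn_ord b'.
    move: (nat_of_ord b) (nat_of_ord b') (q`_t) qt => i i' l lE ib' ib.
    case: (ltrgtP l 0) lE => [l0|l0|->] lE; last by lia.
    - have : l * d%:Z <= -1 * d%:Z by rewrite ler_pM2r //; lia.
      lia.
    - have : 1 * d%:Z <= l * d%:Z by rewrite ler_pM2r //; lia.
      lia.
  move: E qE; rewrite {}bb subrr scale0r addr0 => E qE.
  congr pair; apply: rB; exists q.
    rewrite -(size_map_inj_poly (f := intr : int -> rat)) ?rmorph0 // ?E ?size_subl //.
    exact: intr_inj.
  by rewrite -qE; ring.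
- move=> x [q [qs xE xA]].
  have := wmax q qs; rewrite -xE => /(_ xA)/intrP[k kE].
  have d0z : (0 : int) < d by lia.
  have rE : `|(k %% d)%Z|%:R = k%:~R - (k %/ d)%Z%:~R * d%:R :> rat.
    rewrite natr_absz ger0_norm ?modz_ge0 ?gt_eqF //.
    by rewrite /modz rmorphB rmorphM.
  have bP : (`|(k %% d)%Z| < d)%N.
    by have := ltz_pmod k d0z; have := modz_ge0 k (_ : d%:Z != 0); lia.
  (* With k = d q_t, one has q_t = (k mod d) / d + (k div d). Removing that many copies of w and of
     theta^t kills the coefficient of degree t and leaves an element of the previous step. *)
  have [a [s ss sE]] : exists a, Ztheta_below t
     (x - `|(k %% d)%Z|%:R * ev w theta - (k %/ d)%Z%:~R * theta ^+ t - r a).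
    apply: rS; exists (q - `|(k %% d)%Z|%:R *: w - (k %/ d)%Z%:~R *: 'X^t); split.
    + apply: size_lower.
        do 2?apply: size_subl => //; rewrite (leq_trans (size_scale_leq _ _)) //.
        by rewrite size_polyXn.
      rewrite !coefB !coefZ coefXn eqxx wt mulr1 rE -kE; field.
      exact: d0'.
    + by rewrite !rmorphB /= !map_polyZ /= map_polyXn !hornerE xE ratr_nat ratr_int.
    + do 2?apply: rpredB => //; apply: rpredM => //; rewrite ?rpredX ?rpred_nat //.
      exact: Aint_int.
  exists (a, Ordinal bP); exists (s + (k %/ d)%Z *: 'X^t).
    rewrite (leq_trans (size_polyD _ _)) // geq_max (leq_trans ss) //=.
    by rewrite (leq_trans (size_scale_leq _ _)) // size_polyXn.
  rewrite rmorphD /= map_polyZ map_polyXn !hornerE -sE /=; ring.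
Qed.
End Lattice.

(** * From a triangular local basis to the p-part of the index *)

Section LocalLattice.
Variables (theta : algC) (n D p : nat) (beta : nat -> {poly rat}) (e : nat -> nat).
Hypothesis theta_int : theta \in Aint.
Hypothesis theta_free :
  forall q : {poly rat}, (size q <= n)%N -> ev q theta = 0 -> q = 0.
Hypothesis D_gt0 : (0 < D)%N.
Hypothesis denominator : forall (q : {poly rat}) (i : nat), (size q <= n)%N ->
  ev q theta \in Aint -> D%:R * q`_i \is a Num.int.
Hypothesis p_pr : prime p.
Hypothesis beta_size : forall i, (size (beta i) <= i.+1)%N.
Hypothesis beta_lead : forall i, (beta i)`_i = (p%:R ^+ e i)^-1.

Let p_neq0 : (p%:R : rat) != 0.
Proof. by rewrite pnatr_eq0 -lt0n prime_gt0. Qed.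

Lemma ev_comb (k : nat) (a : nat -> rat) :
  ev (\sum_(i < k) a i *: beta i) theta = \sum_(i < k) ratr (a i) * ev (beta i) theta.
Proof.
rewrite rmorph_sum /= horner_sum; apply: eq_bigr => i _.
by rewrite map_polyZ hornerZ.
Qed.

Lemma size_comb (k : nat) (a : nat -> rat) :
  (size (\sum_(i < k) a i *: beta i)%R <= k)%N.
Proof.
rewrite (leq_trans (size_sum _ _ _)) //; apply/bigmax_leqP => i _.
by rewrite (leq_trans (size_scale_leq _ _)) // (leq_trans (beta_size i)).
Qed.

(** In a combination of degree at most t the coefficients of index above t vanish from the top down,
    because each [beta i] has exact degree i. Then only [beta t] contributes in degree t. *)
Lemma comb_lead (k t : nat) (a : nat -> rat) : (t < k)%N ->
  (size (\sum_(i < k) a i *: beta i)%R <= t.+1)%N ->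
  (\sum_(i < k) a i *: beta i)`_t = a t / p%:R ^+ e t.
Proof.
elim: k => // k IH; rewrite ltnS leq_eqVlt => /predU1P[->|tk].
  by rewrite big_ord_recr /= coefD nth_default ?size_comb // add0r coefZ beta_lead.
move=> st; have ak : a k = 0.
  have : (\sum_(i < k.+1) a i *: beta i)`_k = 0 by rewrite nth_default ?(leq_trans st).
  rewrite big_ord_recr /= coefD nth_default ?size_comb // add0r coefZ beta_lead.
  by move/eqP; rewrite mulf_eq0 invr_eq0 expf_eq0 (negPf p_neq0) andbF orbF => /eqP.
by move: st; rewrite big_ord_recr /= ak scale0r addr0; apply: IH.
Qed.

Lemma comb_free (a : nat -> rat) :
  \sum_(i < n) ratr (a i) * ev (beta i) theta = 0 -> forall i, (i < n)%N -> a i = 0.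
Proof.
rewrite -ev_comb => /(theta_free (size_comb _ _)) s0 i ni.
have := @comb_lead n i a ni; rewrite s0 size_poly0 coef0 => /(_ isT)/esym/eqP.
by rewrite mulf_eq0 invr_eq0 expf_eq0 (negPf p_neq0) andbF orbF => /eqP.
Qed.

Hypothesis beta_int : forall i, (i < n)%N -> ev (beta i) theta \in plocal p.
Hypothesis beta_span : forall q : {poly rat}, (size q <= n)%N ->
  ev q theta \in plocal p -> exists2 a : nat -> rat, (forall i, inZloc p (a i)) &
  ev q theta = \sum_(i < n) ratr (a i) * ev (beta i) theta.

Lemma lead_denominator (t : nat) : (t < n)%N -> exists (d : nat) (w : {poly rat}),
  [/\ (0 < d)%N, (size w <= t.+1)%N, w`_t = d%:R^-1, ev w theta \in Aint &
      forall q : {poly rat}, (size q <= t.+1)%N -> ev q theta \in Aint ->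
        d%:R * q`_t \is a Num.int].
Proof.
move=> tn.
pose L c := exists q : {poly rat},
  [/\ (size q <= t.+1)%N, q`_t = c & ev q theta \in Aint].
have [|||d [d0 [w [ws wt wA]] dmax]] := @fractional_ideal_gen L D _ _ D_gt0.
- move=> _ _ z [q [qs <- qA]] [r [rs <- rA]]; exists (q - z%:~R *: r); split.
  + by rewrite size_subl // (leq_trans (size_scale_leq _ _)).
  + by rewrite coefB coefZ.
  + rewrite rmorphB /= map_polyZ !hornerE /= ratr_int.
    by apply: rpredB => //; apply: rpredM => //; apply: Aint_int.
- exists 'X^t; rewrite size_polyXn coefXn eqxx map_polyXn !hornerE.
  by split=> //; apply: rpredX.
- by move=> _ [q [qs <- qA]]; apply: denominator => //; apply: leq_trans tn.
by exists d, w; split=> // q qs qA; apply: dmax; exists q.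
Qed.

(** Expanding w in the local basis shows 1/d = a_t / p^(e t) with a_t p-integral. Conversely some
    multiple of [beta t] by an integer prime to p lies in O_K, and its leading coefficient is
    subject to the maximality of d. *)
Lemma lead_logn (t d : nat) (w : {poly rat}) : (t < n)%N -> (0 < d)%N ->
  (size w <= t.+1)%N -> w`_t = d%:R^-1 -> ev w theta \in Aint ->
  (forall q : {poly rat}, (size q <= t.+1)%N -> ev q theta \in Aint ->
     d%:R * q`_t \is a Num.int) ->
  logn p d = e t.
Proof.
move=> tn d0 ws wt wA wmax.
have [a aZ] := beta_span (leq_trans ws tn) (Aint_plocal p wA).
rewrite -ev_comb => /(ev_inj theta_free (leq_trans ws tn) (size_comb _ _)) wE.
have ae : a t / p%:R ^+ e t = d%:R^-1 by rewrite -wt wE comb_lead -?wE.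
have /plocalP[k pk kA] := beta_int tn.
apply: (@logn_eq_denominator p d (e t) k) => //.
  by rewrite -ae mulrCA divff ?mulr1 // expf_neq0.
rewrite -beta_lead -coefZ; apply: wmax.
  by rewrite (leq_trans (size_scale_leq _ _)).
by rewrite map_polyZ hornerZ /= ratr_nat.
Qed.

Lemma index_below (t : nat) : (t <= n)%N -> exists N : nat,
  [/\ (0 < N)%N, is_index (Aint_below theta t) (Ztheta_below theta t) N &
      logn p N = \sum_(i < t) e i]%N.
Proof.
elim: t => [_|t IH tn].
  exists 1%N; split=> //; last by rewrite big_ord0 logn1.
  have -> : 1%N = #|{: unit}| by rewrite card_unit.
  apply: (@is_index_card unit _ _ (fun=> 0)) => [[]|[] [] //|x].
    by exists 0; rewrite size_poly0 rmorph0 horner0; split=> //; apply: rpred0.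
  case=> q [/size_poly_leq0P -> -> _]; exists tt; exists 0.
    by rewrite size_poly0.
  by rewrite !rmorph0 !horner0 subr0.
have [N [N0 NI Np]] := IH (ltnW tn).
have [d [w [d0 ws wt wA wmax]]] := lead_denominator tn.
exists (N * d)%N; split; first by rewrite muln_gt0 N0.
  exact: (index_step theta_int theta_free tn d0 ws wt).
by rewrite lognM // Np big_ord_recr /= (lead_logn tn d0 ws wt).
Qed.
End LocalLattice.

(** * Arithmetic of Z_(p) *)

Lemma plocal_ratr (p : nat) (q : rat) : (ratr q \in plocal p) = (q \in inZloc p).
Proof. exact: plocal_rat. Qed.

Fact inZloc_subring (p : nat) : subring_closed (inZloc p).
Proof.
split=> [|x y|x y]; rewrite -!plocal_ratr ?rmorph1 ?rmorphB ?rmorphM.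
- exact: rpred1.
- exact: rpredB.
- exact: rpredM.
Qed.
HB.instance Definition _ p :=
  GRing.isSubringClosed.Build rat (inZloc p) (inZloc_subring p).

Lemma plocal_cancel_int (p : nat) (k : int) (x : algC) :
  coprime p `|k| -> k%:~R * x \in plocal p -> x \in plocal p.
Proof.
move=> pk kx; apply: (plocal_cancel pk).
have -> : `|k|%:R * x = (sgz k)%:~R * (k%:~R * x).
  by rewrite mulrA -intrM natr_absz normrEsg -sgrz.
by apply: rpredM => //; apply: plocal_int.
Qed.

Lemma inZloc_cancel (p : nat) (k : int) (q : rat) :
  coprime p `|k| -> k%:~R * q \in inZloc p -> q \in inZloc p.
Proof.
move=> pk; rewrite -!plocal_ratr rmorphM /= ratr_int.
exact: plocal_cancel_int.
Qed.

Lemma inZloc_divX (p e : nat) (k : int) : prime p ->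
  (k%:~R / p%:R ^+ e \in inZloc p) = (p ^ e %| `|k|)%N.
Proof.
move=> p_pr; have p0 : (p%:R : rat) != 0 by rewrite pnatr_eq0 -lt0n prime_gt0.
rewrite -natrX; have {p0} p0 : ((p ^ e)%:R : rat) != 0 by rewrite natrX expf_neq0.
apply/idP/idP => [kp|/dvdnP[l kl]]; last first.
  have -> : k = sgz k * l%:Z * (p ^ e)%N%:Z by lia.
  by rewrite !rmorphM /= mulfK // rpredM ?rpred_int.
have pd : coprime p `|denq (k%:~R / (p ^ e)%:R)| := kp.
rewrite -(Gauss_dvdr _ (_ : coprime (p ^ e) `|denq (k%:~R / (p ^ e)%:R)|)); last first.
  by rewrite coprimeXl.
have E : numq (k%:~R / (p ^ e)%:R) * (p ^ e)%N = k * denq (k%:~R / (p ^ e)%:R).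
  by apply: (@intr_inj rat); rewrite !intrM numqE -pmulrn mulrAC mulfVK.
by apply/dvdnP; exists `|numq (k%:~R / (p ^ e)%:R)|%N; rewrite -abszM mulrC -E abszM.
Qed.

Lemma inZloc_div (p : nat) (k : int) : prime p ->
  (k%:~R / p%:R \in inZloc p) = (p %| `|k|)%N.
Proof. by move=> p_pr; rewrite -[p%:R]expr1 inZloc_divX // expn1. Qed.

(** Z_(p) and Z have the same residues mod p^e: if u denq(q) + v p^e = 1, then the integer z = u
    numq(q) satisfies q - z = v p^e q. *)
Lemma inZloc_residue (p e : nat) (q : rat) : prime p -> q \in inZloc p ->
  exists2 k : nat, (k < p ^ e)%N & (q - k%:R) / p%:R ^+ e \in inZloc p.
Proof.
move=> p_pr qZ; have p0 : (p%:R : rat) != 0 by rewrite pnatr_eq0 -lt0n prime_gt0.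
have pe0 : (0 : int) < (p ^ e)%N by rewrite ltz_nat expn_gt0 prime_gt0.
have peN : ((p ^ e)%N : int) != 0 by rewrite gt_eqF.
have pd : coprime p `|denq q| := qZ.
have cd : gcdz (denq q) (p ^ e)%N = 1.
  by congr Posz; apply/eqP; rewrite -[_ == _]/(coprime _ _) coprime_sym coprimeXl.
have [u [v]] := Bezoutz (denq q) (p ^ e)%N; rewrite cd => uv.
pose z := u * numq q; exists `|(z %% (p ^ e)%N)%Z|%N.
  by have := ltz_pmod z pe0; have := modz_ge0 z peN; lia.
have -> : (q - `|(z %% (p ^ e)%N)%Z|%:R) / p%:R ^+ e =
    v%:~R * q + (z %/ (p ^ e)%N)%Z%:~R.
  have -> (y : int) : `|(y %% (p ^ e)%N)%Z|%:R =
      y%:~R - (y %/ (p ^ e)%N)%Z%:~R * p%:R ^+ e :> rat.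
    rewrite natr_absz ger0_norm ?modz_ge0 //.
    by rewrite /modz rmorphB rmorphM /= -pmulrn natrX.
  have uv' : u%:~R * (denq q)%:~R + v%:~R * p%:R ^+ e = 1 :> rat.
    by rewrite -natrX pmulrn -!intrM -intrD uv.
  rewrite /z rmorphM /= numqE; move/(canRL (addrK _)): uv' => uv'.
  by rewrite mulrCA uv'; field; rewrite expf_neq0.
by apply: rpredD; rewrite ?rpred_int // rpredM ?rpred_int.
Qed.

(** * Pure cubic fields at 3 *)

(** Substituting X^s for X turns a divisor of X^r - m into a divisor of X^(s r) - m and multiplies
    degrees by s, so a proper divisor stays proper. This supplies the pure subfields of degrees 2, 3
    and 4. *)
Lemma pure_irr_dvd (s r : nat) (m : int) : (0 < s)%N -> (0 < r)%N ->
  pure_irr (s * r) m -> pure_irr r m.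
Proof.
move=> s0 r0 [_ irr]; split; first by rewrite size_XnsubC.
move=> q q1 /dvdpP[g gE].
have f0 : ('X^r - (m%:~R)%:P : {poly rat}) != 0.
  by rewrite -size_poly_eq0 size_XnsubC.
have q0 : q != 0 by apply: contraNneq f0 => q0; rewrite gE q0 mulr0.
have sE : (size (q \Po 'X^s)).-1 = ((size q).-1 * s)%N.
  by rewrite size_comp_poly size_polyXn.
have cE : 'X^(s * r) - (m%:~R)%:P = (g \Po 'X^s) * (q \Po 'X^s) :> {poly rat}.
  rewrite -rmorphM /= -gE rmorphB /= comp_polyC rmorphXn /= comp_polyX.
  by rewrite -exprM.
have sq : (0 < (size q).-1)%N.
  by move: q0 q1; rewrite -size_poly_gt0; case: (size q) => [|[|k]].
have c1 : size (q \Po 'X^s) != 1%N.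
  apply/negP => /eqP c1; move: sE; rewrite c1 /= => /esym/eqP.
  by rewrite muln_eq0 (gtn_eqF sq) (gtn_eqF s0).
have /eqp_size : q \Po 'X^s %= 'X^(s * r) - (m%:~R)%:P.
  by apply: irr c1 _; apply/dvdpP; exists (g \Po 'X^s).
rewrite size_XnsubC ?muln_gt0 ?s0 // => sc.
rewrite -dvdp_size_eqp; last by apply/dvdpP; exists g.
rewrite size_XnsubC //; move: sE; rewrite sc /= mulnC => /eqP.
rewrite eqn_pmul2r // => /eqP ->.
by rewrite prednK // size_poly_gt0.
Qed.

Section Rank.
Variables (n p : nat) (m : int) (t : algC).
Hypotheses (n_gt0 : (0 < n)%N) (irr : pure_irr n m) (tE : t ^+ n = m%:~R).
Hypothesis pm : coprime p `|m|.

Lemma plocal_coef_unit (c : nat -> rat) (i : nat) : (i < n)%N ->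
  \sum_(i < n) ratr (c i) * t ^+ i \in plocal p -> n%:R * c i \in inZloc p.
Proof.
move=> iN cA; apply: (inZloc_cancel pm); rewrite -plocal_ratr mulrCA mulrA.
exact: plocal_coef cA.
Qed.
End Rank.

Lemma plocal_coef2 (p : nat) (m : int) (w : algC) (a b : rat) :
  pure_irr 2 m -> w ^+ 2 = m%:~R -> coprime p `|m| ->
  ratr a + ratr b * w \in plocal p ->
  2 * a \in inZloc p /\ 2 * b \in inZloc p.
Proof.
move=> irr wE pm abA.
have cA : \sum_(i < 2) ratr (nth 0 [:: a; b] i) * w ^+ i \in plocal p.
  by rewrite !big_ord_recr big_ord0 /= add0r mulr1 expr1.
split; [exact: (plocal_coef_unit _ irr wE pm (i := 0) _ cA)|].
exact: (plocal_coef_unit _ irr wE pm (i := 1) _ cA).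
Qed.

Lemma plocal_coef3 (p : nat) (m : int) (y : algC) (a b c : rat) :
  pure_irr 3 m -> y ^+ 3 = m%:~R -> coprime p `|m| ->
  ratr a + ratr b * y + ratr c * y ^+ 2 \in plocal p ->
  [/\ 3 * a \in inZloc p, 3 * b \in inZloc p & 3 * c \in inZloc p].
Proof.
move=> irr yE pm abA.
have cA : \sum_(i < 3) ratr (nth 0 [:: a; b; c] i) * y ^+ i \in plocal p.
  by rewrite !big_ord_recr big_ord0 /= add0r mulr1 expr1.
split; [exact: (plocal_coef_unit _ irr yE pm (i := 0) _ cA)| |].
- exact: (plocal_coef_unit _ irr yE pm (i := 1) _ cA).
- exact: (plocal_coef_unit _ irr yE pm (i := 2) _ cA).
Qed.

Lemma cubic_h_int (m : int) (y : algC) :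
  y ^+ 3 = m%:~R -> (m ^+ 2 = 1 %[mod 9])%Z -> (1 + m%:~R * y + y ^+ 2) / 3 \in Aint.
Proof.
move=> yE m9; have [k kE] : exists k : int, m ^+ 2 = 1 + 9 * k.
  by exists ((m ^+ 2 - 1) %/ 9)%Z; lia.
have kE' : k%:~R = (y ^+ 6 - 1) / 9 :> algC.
  have : (m%:~R : algC) ^+ 2 = 1 + 9 * k%:~R by rewrite -rmorphXn kE rmorphD rmorphM.
  by rewrite -yE -exprM => ->; field.
(* The characteristic polynomial of [(1 + m y + y^2) / 3] when [m^2 = 1 + 9 k]. *)
pose P : {poly algC} := Poly [:: (-3 * k * k)%:~R; (-3 * k)%:~R; (-1)%:~R; 1].
have Ps : polyseq P = [:: (-3 * k * k)%:~R; (-3 * k)%:~R; (-1)%:~R; 1].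
  by rewrite (PolyK (c := 0)) //= oner_eq0.
apply: (@root_monic_Aint P).
- rewrite /root /horner Ps /= !intrM kE' -yE; apply/eqP.
  by field.
- by rewrite monicE lead_coefE Ps.
- apply/(all_nthP 0) => i; rewrite Ps.
  by case: i => [|[|[|[|i]]]] //= _; rewrite ?rpred1 ?rpred_int //; exact: (rpred_int _ _).
Qed.

Section Cubic.
Variables (m : int) (y : algC).
Hypotheses (irr : pure_irr 3 m) (yE : y ^+ 3 = m%:~R) (m3 : ~~ (3 %| `|m|)%N).

Let cop : coprime 3 `|m|.
Proof. by rewrite prime_coprime. Qed.

Lemma cubic_h_not_plocal : ~ (m ^+ 2 = 1 %[mod 9])%Z ->
  (1 + m%:~R * y + y ^+ 2) / 3 \notin plocal 3.
Proof.
move=> m9; apply/negP; set w := _ / 3 => wA.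
have [l [e [mE eE]]] : exists l e : int, m = 3 * l + e /\ e * e = 1.
  have [e3|e3] : (m %% 3 = 1 \/ m %% 3 = 2)%Z by lia.
    by exists (m %/ 3)%Z, 1; split=> //; lia.
  by exists ((m %/ 3)%Z + 1), (-1); split=> //; lia.
have [i iE] : exists i : int, m * m + 2 = 3 * i.
  exists (3 * l * l + 2 * l * e + 1); rewrite mE.
  transitivity (9 * l * l + 6 * l * e + e * e + 2); first by ring.
  by rewrite eE; ring.
(* Here 1 - i = (1 - m^2) / 3, which is prime to 3 because m^2 is 1 mod 3 but not mod 9. *)
have j3 : coprime 3 `|1 - i|.
  by move: m9; rewrite expr2 prime_coprime //; move: (m * m) iE => M; lia.
(* [w^2 - i w = (1 - i) (m y - 1) / 3], and [1 - i] is prime to 3. *)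
have xA : (m%:~R * y - 1) / 3 \in plocal 3.
  have : (1 - i)%:~R * ((m%:~R * y - 1) / 3) \in plocal 3.
    have -> : (1 - i)%:~R * ((m%:~R * y - 1) / 3) = w ^+ 2 - i%:~R * w.
      rewrite rmorphB /=.
      have -> : i%:~R = (m%:~R ^+ 2 + 2) / 3 :> algC.
        have : (m * m + 2)%:~R = (3 * i)%:~R :> algC by rewrite iE.
        by rewrite rmorphD !rmorphM /= -expr2 => ->; field.
      by rewrite /w -yE; field.
    by apply: rpredB; [exact: rpredX | apply: rpredM => //; exact: plocal_int].
  exact: plocal_cancel_int.
(* The square has constant coefficient 1/9, and 3 times it is not 3-integral, against the averaging
   bound. *)
have : ((m%:~R * y - 1) / 3) ^+ 2 \in plocal 3 by apply: rpredX.
have -> : ((m%:~R * y - 1) / 3) ^+ 2 =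
   ratr (1 / 9) + ratr (- 2 * m%:~R / 9) * y + ratr (m%:~R ^+ 2 / 9) * y ^+ 2.
  rewrite !rmorphM /= !fmorphV /= !(ratr_nat _ 9) ratr_int.
  by field.
case/(plocal_coef3 irr yE cop) => + _ _.
have -> : 3 * (1 / 9) = 1%:~R / 3%:R :> rat by field.
by rewrite inZloc_div.
Qed.
End Cubic.

(* The hypotheses are the conditions imposed by the three coefficients of
   [(a + b y + c y^2)^2 / 9] when [y^3 = m]. *)
Lemma square_form_mod3 (m : int) (a b c : nat) :
  ~~ (3 %| `|m|)%N -> (a < 3)%N -> (b < 3)%N -> (c < 3)%N ->
  (3 %| `|(a%:Z * a%:Z + 2 * m * b%:Z * c%:Z)%R|)%N ->
  (3 %| `|(2 * a%:Z * b%:Z + m * c%:Z * c%:Z)%R|)%N ->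
  (3 %| `|(b%:Z * b%:Z + 2 * a%:Z * c%:Z)%R|)%N ->
  (3 %| `|(a%:Z - c%:Z)%R|)%N /\ (3 %| `|(b%:Z - m * c%:Z)%R|)%N.
Proof.
by case: a => [|[|[|//]]] m3 _; case: b => [|[|[|//]]] _;
   case: c => [|[|[|//]]] _; lia.
Qed.

Section CubicCoef.
Variables (m : int) (y : algC).
Hypotheses (irr : pure_irr 3 m) (yE : y ^+ 3 = m%:~R) (m3 : ~~ (3 %| `|m|)%N).

Let cop : coprime 3 `|m|.
Proof. by rewrite prime_coprime. Qed.

Let yA : y \in Aint.
Proof. exact: theta_Aint yE. Qed.

(** Modulo 3-integral coefficients the element is (n0 + n1 y + n2 y^2) / 3 with digits below 3. The
    bound applied to its square forces the digits to be n2 (1, m, 1) mod 3. The conclusion lists the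
    coordinates in the basis (1 + m y + y^2) / 3, 1, y. *)
Lemma cubic_coef (c0 c1 c2 : rat) :
  ratr c0 + ratr c1 * y + ratr c2 * y ^+ 2 \in plocal 3 ->
  [/\ 3 * c2 \in inZloc 3, c0 - c2 \in inZloc 3 & c1 - m%:~R * c2 \in inZloc 3].
Proof.
move=> zA; have [z0 z1 z2] := plocal_coef3 irr yE cop zA.
have [n0 n0_lt r0] := @inZloc_residue 3 1 _ isT z0.
have [n1 n1_lt r1] := @inZloc_residue 3 1 _ isT z1.
have [n2 n2_lt r2] := @inZloc_residue 3 1 _ isT z2.
have yP : y \in plocal 3 by exact: Aint_plocal.
pose z : algC := n0%:R / 3 + n1%:R / 3 * y + n2%:R / 3 * y ^+ 2.
have {}zA : z \in plocal 3.
  have -> : z = ratr c0 + ratr c1 * y + ratr c2 * y ^+ 2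
     - (ratr ((3 * c0 - n0%:R) / 3 ^+ 1) + ratr ((3 * c1 - n1%:R) / 3 ^+ 1) * y
        + ratr ((3 * c2 - n2%:R) / 3 ^+ 1) * y ^+ 2).
    by rewrite /z expr1 !rmorphM !rmorphB !rmorphM /= !fmorphV !ratr_nat; field.
  apply: rpredB => //; do 2?apply: rpredD; rewrite ?plocal_ratr //.
    by apply: rpredM; rewrite ?plocal_ratr.
  by apply: rpredM; rewrite ?plocal_ratr ?rpredX.
have /(plocal_coef3 irr yE cop)[s0 s1 s2] :
    ratr ((n0%:R * n0%:R + 2 * m%:~R * n1%:R * n2%:R) / 9)
    + ratr ((2 * n0%:R * n1%:R + m%:~R * n2%:R * n2%:R) / 9) * y
    + ratr ((n1%:R * n1%:R + 2 * n0%:R * n2%:R) / 9) * y ^+ 2 \in plocal 3.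
  suff <- : z ^+ 2 = ratr ((n0%:R * n0%:R + 2 * m%:~R * n1%:R * n2%:R) / 9)
    + ratr ((2 * n0%:R * n1%:R + m%:~R * n2%:R * n2%:R) / 9) * y
    + ratr ((n1%:R * n1%:R + 2 * n0%:R * n2%:R) / 9) * y ^+ 2 by apply: rpredX.
  rewrite !(rmorphM, rmorphD) /= !fmorphV /= !ratr_nat ratr_int -yE /z.
  by field.
have [] := @square_form_mod3 m n0 n1 n2 m3 n0_lt n1_lt n2_lt.
- rewrite -inZloc_div // !(rmorphM, rmorphD) /= -!pmulrn.
  by have -> : forall x : rat, x / 3 = 3 * (x / 9) by move=> x; field.
- rewrite -inZloc_div // !(rmorphM, rmorphD) /= -!pmulrn.
  by have -> : forall x : rat, x / 3 = 3 * (x / 9) by move=> x; field.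
- rewrite -inZloc_div // !(rmorphM, rmorphD) /= -!pmulrn.
  by have -> : forall x : rat, x / 3 = 3 * (x / 9) by move=> x; field.
rewrite -!inZloc_div // !(rmorphM, rmorphB) /= -!pmulrn => d0 d1; split=> //.
- have -> : c0 - c2 = (3 * c0 - n0%:R) / 3 - (3 * c2 - n2%:R) / 3 + (n0%:R - n2%:R) / 3.
    by field.
  by rewrite rpredD // rpredB.
- have -> : c1 - m%:~R * c2 = (3 * c1 - n1%:R) / 3 - m%:~R * ((3 * c2 - n2%:R) / 3)
      + (n1%:R - m%:~R * n2%:R) / 3 by field.
  by rewrite rpredD // rpredB // rpredM ?rpred_int.
Qed.

(** By [cubic_coef] the element is n (1 + m y + y^2) / 3 up to 3-integral coefficients, with n < 3.
    A nonzero n would be prime to 3 and make (1 + m y + y^2) / 3 itself integral. *)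
Lemma cubic_coef_not9 (c0 c1 c2 : rat) : ~ (m ^+ 2 = 1 %[mod 9])%Z ->
  ratr c0 + ratr c1 * y + ratr c2 * y ^+ 2 \in plocal 3 ->
  [/\ c0 \in inZloc 3, c1 \in inZloc 3 & c2 \in inZloc 3].
Proof.
move=> m9 zA; have [d2 d0 d1] := cubic_coef zA.
suff c2Z : c2 \in inZloc 3.
  split=> //; first by rewrite -(subrK c2 c0) rpredD.
  by rewrite -(subrK (m%:~R * c2) c1) rpredD // rpredM ?rpred_int.
have [n n_lt r] := @inZloc_residue 3 1 _ isT d2.
have hA : n%:R * ((1 + m%:~R * y + y ^+ 2) / 3) \in plocal 3.
  have -> : n%:R * ((1 + m%:~R * y + y ^+ 2) / 3) =
     ratr c0 + ratr c1 * y + ratr c2 * y ^+ 2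
     - ratr (c0 - c2) - ratr (c1 - m%:~R * c2) * y
     - ratr ((3 * c2 - n%:R) / 3 ^+ 1) * (1 + m%:~R * y + y ^+ 2).
    rewrite expr1 !(rmorphM, rmorphB) /= !(rmorphM, fmorphV) /= !ratr_nat ratr_int.
    by field.
  have yP : y \in plocal 3 by exact: Aint_plocal.
  do 3?[apply: rpredB]; rewrite ?plocal_ratr // rpredM ?plocal_ratr //.
  by rewrite !rpredD ?rpredM ?rpredX ?plocal_int ?rpred1.
have n0 : n = 0%N.
  apply/eqP; rewrite -leqn0 leqNgt; apply/negP => n_gt0.
  have /negP := cubic_h_not_plocal irr yE m3 m9; apply.
  by apply: (plocal_cancel _ hA); case: n n_lt n_gt0 {r hA} => [|[|[|]]].
by move: r; rewrite n0 subr0 expr1 mulrC mulKf.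
Qed.
End CubicCoef.

(** * Pure quadratic and quartic fields at 2 *)

Section Quadratic.
Variables (m : int) (w : algC).
Hypotheses (irr : pure_irr 2 m) (wE : w ^+ 2 = m%:~R) (m2 : ~~ (2 %| `|m|)%N).

Let cop : coprime 2 `|m|.
Proof. by rewrite prime_coprime. Qed.

Let wP (p : nat) : w \in plocal p.
Proof. by apply: Aint_plocal; exact: theta_Aint wE. Qed.

(** The digits n0, n1 of 2 a and 2 b mod 2 agree: the square of (n0 + n1 w) / 2 has constant
    coefficient (n0^2 + m n1^2) / 4, so the bound makes n0^2 + m n1^2 even, and m is odd. *)
Lemma quadratic_residue (a b : rat) : ratr a + ratr b * w \in plocal 2 ->
  exists n : nat, [/\ (n < 2)%N, a - n%:R / 2 \in inZloc 2,
    b - n%:R / 2 \in inZloc 2 & n%:R * ((1 + w) / 2) \in plocal 2].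
Proof.
move=> zA; have [z0 z1] := plocal_coef2 irr wE cop zA.
have [n0 n0_lt] := @inZloc_residue 2 1 _ isT z0.
have [n1 n1_lt] := @inZloc_residue 2 1 _ isT z1.
rewrite !expr1 !mulrBl ![2 * _]mulrC !mulfK // => r1 r0.
have {}zA : ratr (n0%:R / 2) + ratr (n1%:R / 2) * w \in plocal 2.
  have -> : ratr (n0%:R / 2) + ratr (n1%:R / 2) * w = ratr a + ratr b * w
     - (ratr (a - n0%:R / 2) + ratr (b - n1%:R / 2) * w).
    by rewrite !rmorphB /=; ring.
  apply: rpredB => //; apply: rpredD; rewrite ?plocal_ratr //.
  by apply: rpredM; [rewrite plocal_ratr | exact: wP].
have /(plocal_coef2 irr wE cop)[s _] :
   ratr ((n0%:R * n0%:R + m%:~R * n1%:R * n1%:R) / 4)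
   + ratr (n0%:R * n1%:R / 2) * w \in plocal 2.
  suff <- : (ratr (n0%:R / 2) + ratr (n1%:R / 2) * w) ^+ 2 =
   ratr ((n0%:R * n0%:R + m%:~R * n1%:R * n1%:R) / 4)
   + ratr (n0%:R * n1%:R / 2) * w by apply: rpredX.
  rewrite !(rmorphM, rmorphD) /= !fmorphV /= !ratr_nat ratr_int -wE.
  by field.
have n01 : n0 = n1.
  have : (2 %| `|(n0%:Z * n0%:Z + m * n1%:Z * n1%:Z)%R|)%N.
    rewrite -inZloc_div // !(rmorphM, rmorphD) /= -!pmulrn.
    by have -> : forall x : rat, x / 2 = 2 * (x / 4) by move=> x; field.
  by move: m2; case: n0 n0_lt {r0 zA s} => [|[|//]] _;
    case: n1 n1_lt {r1} => [|[|//]] _; lia.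
exists n0; split=> //; first by rewrite n01.
have -> : n0%:R * ((1 + w) / 2) = ratr (n0%:R / 2) + ratr (n0%:R / 2) * w.
  by rewrite rmorphM fmorphV /= !ratr_nat; field.
by rewrite {2}n01.
Qed.

Lemma quadratic_coef (a b : rat) : ratr a + ratr b * w \in plocal 2 ->
  [/\ 2 * a \in inZloc 2, 2 * b \in inZloc 2 & a - b \in inZloc 2].
Proof.
move=> zA; have [z0 z1] := plocal_coef2 irr wE cop zA; split=> //.
have [n [_ r0 r1 _]] := quadratic_residue zA.
have -> : a - b = (a - n%:R / 2) - (b - n%:R / 2) by ring.
exact: rpredB.
Qed.

(** If (1 + w) / 2 were integral, so would be its square (1 + m) / 4 + w / 2; its coefficients are
    an integer and 1/2, and their difference is not 2-integral, contrary to [quadratic_coef]. *)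
Lemma quadratic_coef3mod4 (a b : rat) : (m = 3 %[mod 4])%Z ->
  ratr a + ratr b * w \in plocal 2 -> a \in inZloc 2 /\ b \in inZloc 2.
Proof.
move=> m4 /quadratic_residue[n [n_lt r0 r1]].
case: n n_lt r0 r1 => [|[|//]] _; first by rewrite mul0r !subr0.
move=> _ _; rewrite mul1r => hA.
have [j jE] : exists j : int, m = 3 + 4 * j by exists (m %/ 4)%Z; lia.
have : ratr (1 + j%:~R) + ratr (2^-1) * w \in plocal 2.
  suff <- : ((1 + w) / 2) ^+ 2 = ratr (1 + j%:~R) + ratr (2^-1) * w by apply: rpredX.
  have jE' : j%:~R = (w ^+ 2 - 3) / 4 :> algC.
    by rewrite wE jE rmorphD rmorphM /=; field.
  by rewrite rmorphD fmorphV /= ratr_nat ratr_int rmorph1 jE'; field.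
case/quadratic_coef => _ _.
have -> : 1 + j%:~R - 2^-1 = (1 + 2 * j)%:~R / 2%:R :> rat.
  by rewrite rmorphD rmorphM /=; field.
by rewrite inZloc_div //; lia.
Qed.
End Quadratic.

(* In the next three lemmas the two quadratic forms are the coefficients of 1 and
   [u^2] in [(n0 + n1 u + n2 u^2 + n3 u^3)^2] when [u^4 = m]. *)
Lemma square_form_1mod8 (m : int) (n0 n1 n2 n3 : nat) : (m = 1 %[mod 8])%Z ->
  (n0 < 4)%N -> (n1 < 4)%N -> (n2 < 4)%N -> (n3 < 4)%N ->
  (2 %| `|(n0%:Z - n2%:Z)%R|)%N -> (2 %| `|(n1%:Z - n3%:Z)%R|)%N ->
  (4 %| `|(n0%:Z * n0%:Z + m * n2%:Z * n2%:Z + 2 * m * n1%:Z * n3%:Z)%R|)%N ->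
  (4 %| `|(2 * n0%:Z * n2%:Z + n1%:Z * n1%:Z + m * n3%:Z * n3%:Z)%R|)%N ->
  (8 %| `|((n0%:Z * n0%:Z + m * n2%:Z * n2%:Z + 2 * m * n1%:Z * n3%:Z)
         - (2 * n0%:Z * n2%:Z + n1%:Z * n1%:Z + m * n3%:Z * n3%:Z))%R|)%N ->
  exists a b c d : int, [/\ n2%:Z - n3%:Z = 2 * a, n1%:Z - n3%:Z = 2 * d + 4 * b,
    n0%:Z + n2%:Z - 2 * n3%:Z = 2 * d + 4 * c & d = 0 \/ d = 1].
Proof.
move=> mE l0 l1 l2 l3 h1 h2 h3 h4 h5.
have [d1 d2 d3] : [/\ (2 %| `|(n2%:Z - n3%:Z)%R|)%N, (2 %| `|(n1%:Z - n3%:Z)%R|)%N &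
    (4 %| `|(n0%:Z + n2%:Z - n3%:Z - n1%:Z)%R|)%N].
  (* Once m is replaced by 1 + 8 j, each of the 256 choices of digits leaves divisibilities that are
     linear in j. *)
  have [j jE] : exists j : int, m = 1 + 8 * j by exists (m %/ 8)%Z; lia.
  move: l0 l1 l2 l3 h1 h2 h3 h4 h5; rewrite jE {m mE jE}.
  case: n0 => [|[|[|[|//]]]]; case: n1 => [|[|[|[|//]]]] => _ _;
  case: n2 => [|[|[|[|//]]]]; case: n3 => [|[|[|[|//]]]] => _ _ => //= *; split; lia.
(* The digit d, half of r, will be the coefficient of (1 + u) / 2; the conditions on the square do
   not decide it. *)
move=> {h1 h2 h3 h4 h5}; pose r : int := ((n1%:Z - n3%:Z) %% 4)%Z.
have [rE|rE] : r = 0 \/ r = 2 by rewrite /r; lia.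
- exists ((n2%:Z - n3%:Z) %/ 2)%Z, ((n1%:Z - n3%:Z) %/ 4)%Z.
  exists ((n0%:Z + n2%:Z - 2 * n3%:Z) %/ 4)%Z, 0; move: rE; rewrite /r => rE.
  by split; [lia | lia | lia | left].
- exists ((n2%:Z - n3%:Z) %/ 2)%Z, ((n1%:Z - n3%:Z) %/ 4)%Z.
  exists ((n0%:Z + n2%:Z - 2 * n3%:Z) %/ 4)%Z, 1; move: rE; rewrite /r => rE.
  by split; [lia | lia | lia | right].
Qed.

Lemma square_form_5mod8 (m : int) (n0 n1 n2 n3 : nat) : (m = 5 %[mod 8])%Z ->
  (n0 < 4)%N -> (n1 < 4)%N -> (n2 < 4)%N -> (n3 < 4)%N ->
  (2 %| `|(n0%:Z - n2%:Z)%R|)%N -> (2 %| `|(n1%:Z - n3%:Z)%R|)%N ->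
  (4 %| `|(n0%:Z * n0%:Z + m * n2%:Z * n2%:Z + 2 * m * n1%:Z * n3%:Z)%R|)%N ->
  (4 %| `|(2 * n0%:Z * n2%:Z + n1%:Z * n1%:Z + m * n3%:Z * n3%:Z)%R|)%N ->
  (8 %| `|((n0%:Z * n0%:Z + m * n2%:Z * n2%:Z + 2 * m * n1%:Z * n3%:Z)
         - (2 * n0%:Z * n2%:Z + n1%:Z * n1%:Z + m * n3%:Z * n3%:Z))%R|)%N ->
  exists e d f g h k : int, [/\ n3%:Z = e + 2 * f, n2%:Z = e + 2 * g,
    n0%:Z = 2 * d + 4 * h - n2%:Z, n1%:Z = 2 * d + 4 * k - n3%:Z &
    [\/ e = 0 /\ d = 0, e = 0 /\ d = 1, e = 1 /\ d = 0 | e = 1 /\ d = 1]].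
Proof.
move=> mE l0 l1 l2 l3 h1 h2 h3 h4 h5.
have [d1 d2 d3] : [/\ (2 %| `|(n2%:Z - n3%:Z)%R|)%N, (2 %| `|(n0%:Z + n2%:Z)%R|)%N &
    (4 %| `|(n0%:Z + n2%:Z - n3%:Z - n1%:Z)%R|)%N].
  have [j jE] : exists j : int, m = 5 + 8 * j by exists (m %/ 8)%Z; lia.
  move: l0 l1 l2 l3 h1 h2 h3 h4 h5; rewrite jE {m mE jE}.
  case: n0 => [|[|[|[|//]]]]; case: n1 => [|[|[|[|//]]]] => _ _;
  case: n2 => [|[|[|[|//]]]]; case: n3 => [|[|[|[|//]]]] => _ _ => //= *; split; lia.
move=> {h1 h2 h3 h4 h5}.
have [d [h hE dE]] : exists d, exists2 h : int, n0%:Z + n2%:Z = 2 * d + 4 * h & d = 0 \/ d = 1.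
  have : (2 %| `|(n0%:Z + n2%:Z)%R|)%N by [].
  move: (n0%:Z + n2%:Z) => r; move=> r2.
  have [rE|rE] : (r %% 4 = 0 \/ r %% 4 = 2)%Z by lia.
    by exists 0, (r %/ 4)%Z; [lia | left].
  by exists 1, (r %/ 4)%Z; [lia | right].
have [e [f fE eE]] : exists e, exists2 f : int, n3%:Z = e + 2 * f & e = 0 \/ e = 1.
  have [rE|rE] : (n3%:Z %% 2 = 0 \/ n3%:Z %% 2 = 1)%Z by lia.
    by exists 0, (n3%:Z %/ 2)%Z; [lia | left].
  by exists 1, (n3%:Z %/ 2)%Z; [lia | right].
exists e, d, f, ((n2%:Z - e) %/ 2)%Z, h, ((n1%:Z + n3%:Z - 2 * d) %/ 4)%Z.
split; [lia | lia | lia | lia |].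
by case: eE dE => ->; case=> ->;
  [constructor 1 | constructor 2 | constructor 3 | constructor 4].
Qed.

Lemma square_form_3mod4 (m : int) (n0 n1 n2 n3 : nat) : (m = 3 %[mod 4])%Z ->
  (n0 < 4)%N -> (n1 < 4)%N -> (n2 < 4)%N -> (n3 < 4)%N ->
  (2 %| n0)%N -> (2 %| n1)%N -> (2 %| n2)%N -> (2 %| n3)%N ->
  (8 %| `|(n0%:Z * n0%:Z + m * n2%:Z * n2%:Z + 2 * m * n1%:Z * n3%:Z)%R|)%N ->
  (8 %| `|(2 * n0%:Z * n2%:Z + n1%:Z * n1%:Z + m * n3%:Z * n3%:Z)%R|)%N ->
  exists e f : nat, [/\ (e < 2)%N, (f < 2)%N, n0 = (2 * e)%N /\ n2 = (2 * e)%N &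
    n1 = (2 * f)%N /\ n3 = (2 * f)%N].
Proof.
move=> mE l0 l1 l2 l3 h1 h2 h3 h4 h5 h6; exists (n0 %/ 2)%N, (n1 %/ 2)%N.
suff [d1 d2] : n0 = n2 /\ n1 = n3 by split; lia.
have [j jE] : exists j : int, m = 3 + 4 * j by exists (m %/ 4)%Z; lia.
move: l0 l1 l2 l3 h1 h2 h3 h4 h5 h6; rewrite jE {m mE jE}.
case: n0 => [|[|[|[|//]]]]; case: n1 => [|[|[|[|//]]]] => _ _;
  case: n2 => [|[|[|[|//]]]]; case: n3 => [|[|[|[|//]]]] => _ _ => //= *; lia.
Qed.

Section Quartic.
Variables (m : int) (u : algC).
Hypotheses (irr : pure_irr 4 m) (uE : u ^+ 4 = m%:~R) (m2 : ~~ (2 %| `|m|)%N).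

Let w := u ^+ 2.

Let wE : w ^+ 2 = m%:~R.
Proof. by rewrite /w -exprM. Qed.

Let irr2 : pure_irr 2 m.
Proof. exact: (@pure_irr_dvd 2 2). Qed.

Let cop : coprime 2 `|m|.
Proof. by rewrite prime_coprime. Qed.

Let uA : u \in Aint.
Proof. exact: theta_Aint uE. Qed.

Let uP (p k : nat) : u ^+ k \in plocal p.
Proof. by apply: rpredX; apply: Aint_plocal. Qed.

Definition quartic_val (c0 c1 c2 c3 : rat) : algC :=
  ratr c0 + ratr c1 * u + ratr c2 * u ^+ 2 + ratr c3 * u ^+ 3.

Lemma quartic_val_plocal (c0 c1 c2 c3 : rat) :
  c0 \in inZloc 2 -> c1 \in inZloc 2 -> c2 \in inZloc 2 -> c3 \in inZloc 2 ->
  quartic_val c0 c1 c2 c3 \in plocal 2.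
Proof.
move=> h0 h1 h2 h3; apply: rpredD; [apply: rpredD; [apply: rpredD|]|].
- by rewrite plocal_ratr.
- by apply: rpredM; [rewrite plocal_ratr | exact: (uP 2 1)].
- by apply: rpredM; [rewrite plocal_ratr | exact: uP].
- by apply: rpredM; [rewrite plocal_ratr | exact: uP].
Qed.

Lemma quartic_valB (c0 c1 c2 c3 d0 d1 d2 d3 : rat) :
  quartic_val c0 c1 c2 c3 - quartic_val d0 d1 d2 d3 =
  quartic_val (c0 - d0) (c1 - d1) (c2 - d2) (c3 - d3).
Proof. by rewrite /quartic_val !rmorphB /=; ring. Qed.

Lemma quartic_coef4 (c0 c1 c2 c3 : rat) :
  quartic_val c0 c1 c2 c3 \in plocal 2 ->
  [/\ 4 * c0 \in inZloc 2, 4 * c1 \in inZloc 2,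
      4 * c2 \in inZloc 2 & 4 * c3 \in inZloc 2].
Proof.
move=> zA.
have cA : \sum_(i < 4) ratr (nth 0 [:: c0; c1; c2; c3] i) * u ^+ i \in plocal 2.
  by rewrite !big_ord_recr big_ord0 /= add0r mulr1 expr1.
split; [exact: (plocal_coef_unit _ irr uE cop (i := 0) _ cA)| | |].
- exact: (plocal_coef_unit _ irr uE cop (i := 1) _ cA).
- exact: (plocal_coef_unit _ irr uE cop (i := 2) _ cA).
- exact: (plocal_coef_unit _ irr uE cop (i := 3) _ cA).
Qed.

(** This is the projection for s = 2. The factor 2 is not a unit here and stays in the conclusion,
    while the factor u of the odd part is a unit and is removed. *)
Lemma quartic_even_odd (c0 c1 c2 c3 : rat) :
  quartic_val c0 c1 c2 c3 \in plocal 2 ->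
  ratr (2 * c0) + ratr (2 * c2) * w \in plocal 2 /\
  ratr (2 * c1) + ratr (2 * c3) * w \in plocal 2.
Proof.
move=> zA.
have cA : \sum_(i < 4) ratr (nth 0 [:: c0; c1; c2; c3] i) * u ^+ i \in plocal 2.
  by rewrite !big_ord_recr big_ord0 /= add0r mulr1 expr1.
split.
- have := plocal_component (s := 2) (j := 0) irr uE isT isT cA.
  rewrite big_mkcond !big_ord_recr big_ord0 /= !add0r !addr0 mulr1.
  by rewrite !rmorphM /= ratr_nat mulrDr !mulrA.
- have := plocal_component (s := 2) (j := 1) irr uE isT isT cA.
  rewrite big_mkcond !big_ord_recr big_ord0 /= !add0r !addr0 => oA.
  apply: (@pure_unit 4 m u isT uE 2 _ 1 cop).
  suff -> : u ^+ 1 * (ratr (2 * c1) + ratr (2 * c3) * w) =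
    2%:R * (ratr c1 * u ^+ 1 + ratr c3 * u ^+ 3) by [].
  by rewrite !rmorphM /= ratr_nat /w; ring.
Qed.

Lemma quartic_square (a b c d : rat) :
  quartic_val a b c d ^+ 2 =
  quartic_val (a * a + m%:~R * c * c + 2 * m%:~R * b * d) (2 * a * b + 2 * m%:~R * c * d)
              (2 * a * c + b * b + m%:~R * d * d) (2 * a * d + 2 * b * c).
Proof.
rewrite /quartic_val !(rmorphM, rmorphD) /= ?(ratr_nat _ 2) ?rmorph1 ratr_int -uE.
by ring.
Qed.

Lemma quartic_residue (c0 c1 c2 c3 : rat) : quartic_val c0 c1 c2 c3 \in plocal 2 ->
  exists n0 n1 n2 n3 : nat,
  [/\ [/\ n0 < 4, n1 < 4, n2 < 4 & n3 < 4]%N,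
      [/\ c0 - n0%:R / 4 \in inZloc 2, c1 - n1%:R / 4 \in inZloc 2,
          c2 - n2%:R / 4 \in inZloc 2 & c3 - n3%:R / 4 \in inZloc 2] &
      quartic_val (n0%:R / 4) (n1%:R / 4) (n2%:R / 4) (n3%:R / 4) \in plocal 2].
Proof.
move=> zA; have [z0 z1 z2 z3] := quartic_coef4 zA.
have residue (c : rat) : 4 * c \in inZloc 2 ->
    exists2 n : nat, (n < 4)%N & c - n%:R / 4 \in inZloc 2.
  case/(@inZloc_residue 2 2 _ isT) => n n_lt r; exists n => //.
  suff <- : (4 * c - n%:R) / 2 ^+ 2 = c - n%:R / 4 by [].
  by field.
have [n0 l0 r0] := residue _ z0; have [n1 l1 r1] := residue _ z1.
have [n2 l2 r2] := residue _ z2; have [n3 l3 r3] := residue _ z3.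
exists n0, n1, n2, n3; split=> //.
have -> : quartic_val (n0%:R / 4) (n1%:R / 4) (n2%:R / 4) (n3%:R / 4) =
  quartic_val c0 c1 c2 c3 - quartic_val (c0 - n0%:R / 4) (c1 - n1%:R / 4)
    (c2 - n2%:R / 4) (c3 - n3%:R / 4).
  by rewrite quartic_valB !subKr.
by apply: rpredB => //; apply: quartic_val_plocal.
Qed.

(** [quadratic_coef] is applied over the field of w = u^2 to twice the even and odd parts of the
    element, and to twice the even part of its square. A / 16 and B / 16 are the coefficients of 1
    and u^2 in that square. *)
Lemma quartic_conditions (n0 n1 n2 n3 : nat)
  (A := n0%:Z * n0%:Z + m * n2%:Z * n2%:Z + 2 * m * n1%:Z * n3%:Z)
  (B := 2 * n0%:Z * n2%:Z + n1%:Z * n1%:Z + m * n3%:Z * n3%:Z) :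
  quartic_val (n0%:R / 4) (n1%:R / 4) (n2%:R / 4) (n3%:R / 4) \in plocal 2 ->
  [/\ (2 %| `|(n0%:Z - n2%:Z)%R|)%N, (2 %| `|(n1%:Z - n3%:Z)%R|)%N,
      (4 %| `|A|)%N, (4 %| `|B|)%N & (8 %| `|(A - B)%R|)%N].
Proof.
move=> zA.
have [e o] := quartic_even_odd zA.
have [_ _ e1] := quadratic_coef irr2 wE m2 e.
have [_ _ o1] := quadratic_coef irr2 wE m2 o.
have : quartic_val (n0%:R / 4) (n1%:R / 4) (n2%:R / 4) (n3%:R / 4) ^+ 2 \in plocal 2.
  exact: rpredX.
rewrite quartic_square => /quartic_even_odd[s _].
have [sA sB sAB] := quadratic_coef irr2 wE m2 s.
have int_div (k : int) (j : nat) (q : rat) : q = k%:~R / 2%:R ^+ j ->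
    q \in inZloc 2 -> (2 ^ j %| `|k|)%N.
  by move=> ->; rewrite inZloc_divX.
split.
- by apply: (int_div _ 1%N _ _ e1); rewrite rmorphB /= -!pmulrn; field.
- by apply: (int_div _ 1%N _ _ o1); rewrite rmorphB /= -!pmulrn; field.
- by apply: (int_div _ 2%N _ _ sA); rewrite /A !(rmorphM, rmorphD) /= -!pmulrn; field.
- by apply: (int_div _ 2%N _ _ sB); rewrite /B !(rmorphM, rmorphD) /= -!pmulrn; field.
- apply: (int_div _ 3%N _ _ sAB).
  by rewrite rmorphB /A /B !(rmorphM, rmorphD) /= -!pmulrn; field.
Qed.

Lemma quartic_conditions3mod4 (n0 n1 n2 n3 : nat)
  (A := n0%:Z * n0%:Z + m * n2%:Z * n2%:Z + 2 * m * n1%:Z * n3%:Z)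
  (B := 2 * n0%:Z * n2%:Z + n1%:Z * n1%:Z + m * n3%:Z * n3%:Z) :
  (m = 3 %[mod 4])%Z ->
  quartic_val (n0%:R / 4) (n1%:R / 4) (n2%:R / 4) (n3%:R / 4) \in plocal 2 ->
  [/\ (2 %| n0)%N /\ (2 %| n1)%N, (2 %| n2)%N /\ (2 %| n3)%N,
      (8 %| `|A|)%N & (8 %| `|B|)%N].
Proof.
move=> m4 zA; have [e o] := quartic_even_odd zA.
have [e0 e2] := quadratic_coef3mod4 irr2 wE m2 m4 e.
have [o1 o3] := quadratic_coef3mod4 irr2 wE m2 m4 o.
have : quartic_val (n0%:R / 4) (n1%:R / 4) (n2%:R / 4) (n3%:R / 4) ^+ 2 \in plocal 2.
  exact: rpredX.
rewrite quartic_square => /quartic_even_odd[s _].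
have [sA sB] := quadratic_coef3mod4 irr2 wE m2 m4 s.
have int_div (k : int) (j : nat) (q : rat) : q = k%:~R / 2%:R ^+ j ->
    q \in inZloc 2 -> (2 ^ j %| `|k|)%N.
  by move=> ->; rewrite inZloc_divX.
split; [split | split | |].
- by apply: (int_div n0 1%N _ _ e0); rewrite -!pmulrn; field.
- by apply: (int_div n1 1%N _ _ o1); rewrite -!pmulrn; field.
- by apply: (int_div n2 1%N _ _ e2); rewrite -!pmulrn; field.
- by apply: (int_div n3 1%N _ _ o3); rewrite -!pmulrn; field.
- by apply: (int_div _ 3%N _ _ sA); rewrite /A !(rmorphM, rmorphD) /= -!pmulrn; field.
- by apply: (int_div _ 3%N _ _ sB); rewrite /B !(rmorphM, rmorphD) /= -!pmulrn; field.
Qed.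

(** For x = (1 + u) / 2 one has x^2 - x = (w - 1) / 4, whose denominator 4 exceeds the bound 2 of
    the quadratic field. *)
Lemma half_1u_not_plocal : (m = 1 %[mod 4])%Z -> (1 + u) / 2 \notin plocal 2.
Proof.
move=> m4; apply/negP => xA.
have : ratr (- (1 / 4)) + ratr (1 / 4) * w \in plocal 2.
  suff <- : ((1 + u) / 2) ^+ 2 - (1 + u) / 2 = ratr (- (1 / 4)) + ratr (1 / 4) * w.
    by apply: rpredB => //; apply: rpredX.
  rewrite rmorphN !rmorphM /= fmorphV /= ratr_nat rmorph1 /w; by field.
case/(plocal_coef2 irr2 wE cop) => _.
have -> : 2 * (1 / 4) = 1%:~R / 2%:R :> rat by field.
by rewrite inZloc_div.
Qed.
End Quartic.

Lemma half_notin_inZloc (k : int) : ~~ (2 %| `|k|)%N -> k%:~R / 2 \notin inZloc 2.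
Proof. by rewrite -[2]/(2%:R) inZloc_div. Qed.

Lemma quartic_w_int (m : int) (u : algC) :
  u ^+ 4 = m%:~R -> (m = 1 %[mod 4])%Z -> (u ^+ 2 - 1) / 2 \in Aint.
Proof.
move=> uE m4; have [k kE] : exists k : int, m = 1 + 4 * k by exists (m %/ 4)%Z; lia.
have kE' : k%:~R = (u ^+ 4 - 1) / 4 :> algC.
  by rewrite uE kE rmorphD rmorphM /=; field.
(* With w = u^2 and w^2 = 1 + 4 k, the element (w - 1) / 2 is a root of X^2 + X - k. *)
pose P : {poly algC} := Poly [:: (- k)%:~R; 1%:~R; 1].
have Ps : polyseq P = [:: (- k)%:~R; 1%:~R; 1].
  by rewrite (PolyK (c := 0)) //= oner_eq0.
apply: (@root_monic_Aint P).
- rewrite /root /horner Ps /= intrN kE'; apply/eqP.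
  by field.
- by rewrite monicE lead_coefE Ps.
- apply/(all_nthP 0) => i; rewrite Ps.
  by case: i => [|[|[|i]]] //= _; rewrite ?rpred1 ?rpred_int //; exact: (rpred_int _ _).
Qed.

Lemma quartic_g_int (m : int) (u : algC) :
  u ^+ 4 = m%:~R -> (m = 1 %[mod 8])%Z -> (u ^+ 3 + u ^+ 2 + u + 1) / 4 \in Aint.
Proof.
move=> uE m8; have [k kE] : exists k : int, m = 1 + 8 * k by exists (m %/ 8)%Z; lia.
have kE' : k%:~R = (u ^+ 4 - 1) / 8 :> algC.
  by rewrite uE kE rmorphD rmorphM /=; field.
(* Here [x = (1 + u + u^2 + u^3) / 4 = 2 k / (u - 1)]; substitute
   [u = 1 + 2 k / x] into [u^4 = 1 + 8 k]. *)
pose P : {poly algC} := Poly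
  [:: (- (2 * k * k * k))%:~R; (- (4 * k * k))%:~R; (- (3 * k))%:~R; (-1)%:~R; 1].
have Ps : polyseq P =
    [:: (- (2 * k * k * k))%:~R; (- (4 * k * k))%:~R; (- (3 * k))%:~R; (-1)%:~R; 1].
  by rewrite (PolyK (c := 0)) //= oner_eq0.
apply: (@root_monic_Aint P).
- rewrite /root /horner Ps /= !intrN !intrM kE'; apply/eqP.
  by field.
- by rewrite monicE lead_coefE Ps.
- apply/(all_nthP 0) => i; rewrite Ps.
  by case: i => [|[|[|[|[|i]]]]] //= _; rewrite ?rpred1 ?rpred_int //; exact: (rpred_int _ _).
Qed.

Section QuarticCoef.
Variables (m : int) (u : algC).
Hypotheses (irr : pure_irr 4 m) (uE : u ^+ 4 = m%:~R) (m2 : ~~ (2 %| `|m|)%N).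

Let wE : (u ^+ 2) ^+ 2 = m%:~R.
Proof. by rewrite -exprM. Qed.

Let irr2 : pure_irr 2 m.
Proof. exact: (@pure_irr_dvd 2 2). Qed.

Let cop : coprime 2 `|m|.
Proof. by rewrite prime_coprime. Qed.

Let uA : u \in Aint.
Proof. exact: theta_Aint uE. Qed.

Let uP (p k : nat) : u ^+ k \in plocal p.
Proof. by apply: rpredX; apply: Aint_plocal. Qed.

(** The conditions reduce the element to (e + f u) (1 + u^2) / 2 with e, f in {0, 1}. As u is a
    unit, the non-integrality of (1 + u^2) / 2 excludes exactly one of e, f being 1; the case e = f
    = 1 needs one more squaring. *)
Lemma quartic_coef3mod4 (c0 c1 c2 c3 : rat) : (m = 3 %[mod 4])%Z ->
  quartic_val u c0 c1 c2 c3 \in plocal 2 ->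
  [/\ c0 \in inZloc 2, c1 \in inZloc 2, c2 \in inZloc 2 & c3 \in inZloc 2].
Proof.
move=> m4 zA.
have [j jE] : exists j : int, m = 3 + 4 * j by exists (m %/ 4)%Z; lia.
move: zA => /(quartic_residue irr uE m2)[n0 [n1 [n2 [n3 [[l0 l1 l2 l3] [r0 r1 r2 r3] zA]]]]].
have [[d0 d1] [d2 d3] sA sB] := quartic_conditions3mod4 irr uE m2 m4 zA.
have [e [f [e2 f2 [nE0 nE2] [nE1 nE3]]]] :=
  square_form_3mod4 m4 l0 l1 l2 l3 d0 d1 d2 d3 sA sB.
have half1w : (1 + u ^+ 2) / 2 \notin plocal 2.
  apply/negP => xA.
  have : ratr (1 / 2) + ratr (1 / 2) * u ^+ 2 \in plocal 2.
    suff -> : ratr (1 / 2) + ratr (1 / 2) * u ^+ 2 = (1 + u ^+ 2) / 2 by [].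
    by rewrite rmorphM fmorphV /= ratr_nat rmorph1; field.
  case/(quadratic_coef3mod4 irr2 wE m2 m4) => /negP/negP.
  by rewrite (negPf (half_notin_inZloc (k := 1) isT)).
have {zA} zA : (e%:R + f%:R * u) * ((1 + u ^+ 2) / 2) \in plocal 2.
  suff <- : quartic_val u (n0%:R / 4) (n1%:R / 4) (n2%:R / 4) (n3%:R / 4) =
     (e%:R + f%:R * u) * ((1 + u ^+ 2) / 2) by [].
  rewrite nE0 nE1 nE2 nE3 /quartic_val !rmorphM /= !fmorphV /= !ratr_nat !natrM.
  by field.
have jE' : j%:~R = (u ^+ 4 - 3) / 4 :> algC.
  by rewrite uE jE rmorphD rmorphM /=; field.
suff [e0 f0] : e = 0%N /\ f = 0%N.
  by move: r0 r1 r2 r3; rewrite nE0 nE1 nE2 nE3 e0 f0 !mul0r !subr0.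
move: zA {nE0 nE1 nE2 nE3}; case: e e2 => [|[|//]] _; case: f f2 => [|[|//]] _ //.
- rewrite mul1r add0r => zA; move/negP: half1w; case.
  exact: (@pure_unit 4 m u isT uE 2 _ 1 cop).
- by rewrite mul0r addr0 mul1r (negPf half1w).
rewrite !mul1r => zA; suff : ratr (m%:~R / 2) + ratr (1 / 2) * u ^+ 2 \in plocal 2.
  case/(quadratic_coef3mod4 irr2 wE m2 m4) => /negP/negP.
  by rewrite (negPf (half_notin_inZloc m2)).
(* Since 1 + m = 4 (1 + j), the square of (1 + u) (1 + u^2) / 2 is (1 + j) (1 + u)^2 + u^3 + (m +
   u^2) / 2. The last term is not integral, m being odd. *)
have -> : ratr (m%:~R / 2) + ratr (1 / 2) * u ^+ 2 =
  ((1 + u) * ((1 + u ^+ 2) / 2)) ^+ 2 - (1 + j%:~R) * (1 + u ^+ 2 + 2 * u) - u ^+ 3.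
  by rewrite !rmorphM fmorphV /= ratr_nat ratr_int rmorph1 jE' -uE; field.
apply: rpredB; last exact: uP.
apply: rpredB; first exact: rpredX.
apply: rpredM; first by apply: rpredD; [exact: rpred1 | exact: plocal_int].
apply: rpredD; last by apply: rpredM; [exact: natr_plocal | exact: (uP 2 1)].
by apply: rpredD; [exact: rpred1 | exact: uP].
Qed.

(** Let W = (u^2 - 1) / 2, which is integral. Removing multiples of W, u W, 1 and u leaves (1 + u)
    (e W + d) / 2 with e, d in {0, 1}, which must be shown to vanish. *)
Lemma quartic_coef5mod8 (c0 c1 c2 c3 : rat) : (m = 5 %[mod 8])%Z ->
  quartic_val u c0 c1 c2 c3 \in plocal 2 ->
  [/\ 2 * c2 \in inZloc 2, 2 * c3 \in inZloc 2,
      c0 + c2 \in inZloc 2 & c1 + c3 \in inZloc 2].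
Proof.
move=> m8; have m4 : (m = 1 %[mod 4])%Z by lia.
have [j jE] : exists j : int, m = 1 + 4 * j by exists (m %/ 4)%Z; lia.
have j2 : coprime 2 `|j| by rewrite prime_coprime //; lia.
have WP := Aint_plocal 2 (quartic_w_int uE m4).
move=> /(quartic_residue irr uE m2)[n0 [n1 [n2 [n3 [[l0 l1 l2 l3] [r0 r1 r2 r3] zA]]]]].
have [h1 h2 h3 h4 h5] := quartic_conditions irr uE m2 zA.
have [e [d [f [g [h [k [nE3 nE2 nE0 nE1 ed]]]]]]] :=
  square_form_5mod8 m8 l0 l1 l2 l3 h1 h2 h3 h4 h5.
have {}nE3 : n3%:R = e%:~R + 2 * f%:~R :> rat by rewrite pmulrn nE3 rmorphD rmorphM.
have {}nE2 : n2%:R = e%:~R + 2 * g%:~R :> rat by rewrite pmulrn nE2 rmorphD rmorphM.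
have {}nE0 : n0%:R = 2 * d%:~R + 4 * h%:~R - n2%:R :> rat.
  by rewrite pmulrn nE0 rmorphB rmorphD !rmorphM.
have {}nE1 : n1%:R = 2 * d%:~R + 4 * k%:~R - n3%:R :> rat.
  by rewrite pmulrn nE1 rmorphB rmorphD !rmorphM.
have {zA} xA : (1 + u) * ((e%:~R * (u ^+ 2 - 1) + 2 * d%:~R) / 4) \in plocal 2.
  have -> : (1 + u) * ((e%:~R * (u ^+ 2 - 1) + 2 * d%:~R) / 4) =
    quartic_val u (n0%:R / 4) (n1%:R / 4) (n2%:R / 4) (n3%:R / 4)
    - (f%:~R * u ^+ 1 + g%:~R) * ((u ^+ 2 - 1) / 2) - h%:~R - k%:~R * u ^+ 1.
    rewrite nE0 nE1 nE3 nE2 /quartic_val !(rmorphM, rmorphB) /= !fmorphV /=.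
    rewrite !(ratr_int, rmorphB, rmorphD, rmorphM) /=
      ?(ratr_nat _ 2) ?(ratr_nat _ 4) ?rmorph1 ?ratr_int.
    by field.
  apply: rpredB; last by apply: rpredM; [exact: plocal_int | exact: uP].
  apply: rpredB; last exact: plocal_int.
  apply: rpredB => //; apply: rpredM => //; apply: rpredD; last exact: plocal_int.
  by apply: rpredM; [exact: plocal_int | exact: uP].
have nhalf := half_1u_not_plocal irr uE m2 m4.
have jE' : j%:~R = (u ^+ 4 - 1) / 4 :> algC.
  by rewrite uE jE rmorphD rmorphM /=; field.
(* W (W + 1) = j, and j is odd exactly because m is 5 rather than 1 mod 8. So W and W + 1 are units
   at 2, and each nonzero choice of (e, d) would make (1 + u) / 2 integral. *)
have [e0 d0] : e = 0 /\ d = 0.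
  case: ed xA => // -[-> ->]; rewrite ?mul0r ?mul1r ?mulr0 ?mulr1 ?add0r ?addr0 => xA;
    move/negP: nhalf; case.
  - suff -> : (1 + u) / 2 = (1 + u) * (2 / 4) by [].
    by field.
  - apply: (plocal_cancel_int j2).
    have -> : j%:~R * ((1 + u) / 2) = (1 + u) * ((u ^+ 2 - 1) / 4) * ((u ^+ 2 - 1) / 2 + 1).
      by rewrite jE'; field.
    by apply: rpredM => //; apply: rpredD => //; exact: rpred1.
  - apply: (plocal_cancel_int j2).
    have -> : j%:~R * ((1 + u) / 2) = (1 + u) * ((u ^+ 2 - 1 + 2) / 4) * ((u ^+ 2 - 1) / 2).
      by rewrite jE'; field.
    exact: rpredM.
move: nE0 nE1 nE2 nE3; rewrite {}e0 {}d0 {ed xA} !mulr0 !add0r => nE0 nE1 nE2 nE3.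
split.
- have -> : 2 * c2 = 2 * (c2 - n2%:R / 4) + g%:~R by rewrite nE2; field.
  by apply: rpredD; [apply: rpredM => //; exact: rpred_nat | exact: rpred_int].
- have -> : 2 * c3 = 2 * (c3 - n3%:R / 4) + f%:~R by rewrite nE3; field.
  by apply: rpredD; [apply: rpredM => //; exact: rpred_nat | exact: rpred_int].
- have -> : c0 + c2 = (c0 - n0%:R / 4) + (c2 - n2%:R / 4) + h%:~R by rewrite nE0; field.
  by apply: rpredD; [exact: rpredD | exact: rpred_int].
- have -> : c1 + c3 = (c1 - n1%:R / 4) + (c3 - n3%:R / 4) + k%:~R by rewrite nE1; field.
  by apply: rpredD; [exact: rpredD | exact: rpred_int].
Qed.

(** Subtracting multiples of (1 + u + u^2 + u^3) / 4, (u^2 - 1) / 2, u and 1 leaves d (1 + u) / 2,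
    so d = 0. The conclusion lists the coordinates on these four elements in this order. *)
Lemma quartic_coef1mod8 (c0 c1 c2 c3 : rat) : (m = 1 %[mod 8])%Z ->
  quartic_val u c0 c1 c2 c3 \in plocal 2 ->
  [/\ 4 * c3 \in inZloc 2, 2 * (c2 - c3) \in inZloc 2,
      c1 - c3 \in inZloc 2 & c0 + c2 - 2 * c3 \in inZloc 2].
Proof.
move=> m8; have m4 : (m = 1 %[mod 4])%Z by lia.
have WP := Aint_plocal 2 (quartic_w_int uE m4).
have GP := Aint_plocal 2 (quartic_g_int uE m8).
move=> zA0; have [_ _ _ c3Z] := quartic_coef4 irr uE m2 zA0.
move: zA0 => /(quartic_residue irr uE m2)[n0 [n1 [n2 [n3 [[l0 l1 l2 l3] [r0 r1 r2 r3] zA]]]]].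
have [h1 h2 h3 h4 h5] := quartic_conditions irr uE m2 zA.
have [a [b [c [d [nE2 nE1 nE0 dE]]]]] :=
  square_form_1mod8 m8 l0 l1 l2 l3 h1 h2 h3 h4 h5.
have {}nE2 : n2%:R = n3%:R + 2 * a%:~R :> rat.
  have : (n2%:Z - n3%:Z)%:~R = (2 * a)%:~R :> rat by rewrite nE2.
  by rewrite rmorphB rmorphM /= -!pmulrn => <-; ring.
have {}nE1 : n1%:R = n3%:R + 2 * d%:~R + 4 * b%:~R :> rat.
  have : (n1%:Z - n3%:Z)%:~R = (2 * d + 4 * b)%:~R :> rat by rewrite nE1.
  by rewrite rmorphB rmorphD !rmorphM /= -!pmulrn -addrA => <-; ring.
have {}nE0 : n0%:R = 2 * n3%:R + 2 * d%:~R + 4 * c%:~R - n2%:R :> rat.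
  have : (n0%:Z + n2%:Z - 2 * n3%:Z)%:~R = (2 * d + 4 * c)%:~R :> rat by rewrite nE0.
  rewrite rmorphB !rmorphD !rmorphM /= -!pmulrn => E.
  by rewrite -(addrA (2 * n3%:R)) -E; ring.
have {zA} xA : d%:~R * ((1 + u) / 2) \in plocal 2.
  have -> : d%:~R * ((1 + u) / 2) =
    quartic_val u (n0%:R / 4) (n1%:R / 4) (n2%:R / 4) (n3%:R / 4)
    - n3%:R * ((u ^+ 3 + u ^+ 2 + u + 1) / 4)
    - a%:~R * ((u ^+ 2 - 1) / 2) - c%:~R - b%:~R * u ^+ 1.
    rewrite nE0 nE1 nE2 /quartic_val !(rmorphM, rmorphB) /= !fmorphV /=.
    rewrite !(ratr_int, ratr_nat, rmorphB, rmorphD, rmorphM) /=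
      ?(ratr_nat _ 2) ?(ratr_nat _ 4) ?rmorph1 ?ratr_int.
    by field.
  apply: rpredB; last by apply: rpredM; [exact: plocal_int | exact: uP].
  apply: rpredB; last exact: plocal_int.
  apply: rpredB; last by apply: rpredM => //; exact: plocal_int.
  by apply: rpredB => //; apply: rpredM => //; exact: natr_plocal.
have d0 : d = 0.
  case: dE xA => // ->; rewrite mul1r.
  by rewrite (negPf (half_1u_not_plocal irr uE m2 m4)).
move: nE0 nE1; rewrite {}d0 {dE xA} !mulr0 !addr0 => nE0 nE1.
split=> //.
- have -> : 2 * (c2 - c3) = 2 * (c2 - n2%:R / 4) - 2 * (c3 - n3%:R / 4) + a%:~R.
    by rewrite nE2; field.
  apply: rpredD; last exact: rpred_int.
  by apply: rpredB; apply: rpredM => //; exact: rpred_nat.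
- have -> : c1 - c3 = (c1 - n1%:R / 4) - (c3 - n3%:R / 4) + b%:~R by rewrite nE1; field.
  by apply: rpredD; [exact: rpredB | exact: rpred_int].
- have -> : c0 + c2 - 2 * c3 = (c0 - n0%:R / 4) + (c2 - n2%:R / 4)
    - 2 * (c3 - n3%:R / 4) + c%:~R by rewrite nE0; field.
  apply: rpredD; last exact: rpred_int.
  by apply: rpredB; [exact: rpredD | apply: rpredM => //; exact: rpred_nat].
Qed.
End QuarticCoef.

(** * Valuations and the ramified case *)

(** At 0 the value is 0 by default, not infinity; hence the nonvanishing hypotheses below. *)
Definition pval (p : nat) (q : rat) : int :=
  (logn p `|numq q|)%:Z - (logn p `|denq q|)%:Z.

Lemma pval_frac (p : nat) (a b : int) : a != 0 -> b != 0 ->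
  pval p (a%:~R / b%:~R) = (logn p `|a|)%:Z - (logn p `|b|)%:Z.
Proof.
move=> a0 b0; set q := _ / _.
have b0' : (b%:~R : rat) != 0 by rewrite intr_eq0.
have q0 : q != 0 by rewrite mulf_neq0 ?invr_eq0 ?intr_eq0.
have : numq q * b = a * denq q.
  by apply: (@intr_inj rat); rewrite !intrM numqE /q mulrAC mulfVK.
move/(congr1 absz); rewrite !abszM => /(congr1 (logn p)).
rewrite !lognM ?absz_gt0 ?denq_neq0 ?numq_eq0 // /pval; lia.
Qed.

Section Valuation.
Variable p : nat.
Hypothesis p_pr : prime p.

Let p_neq0 : (p%:R : rat) != 0.
Proof. by rewrite pnatr_eq0 -lt0n prime_gt0. Qed.

Lemma pvalM (q r : rat) : q != 0 -> r != 0 -> pval p (q * r) = pval p q + pval p r.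
Proof.
move=> q0 r0; have -> : q * r = (numq q * numq r)%:~R / (denq q * denq r)%:~R.
  by rewrite !intrM !numqE; field; rewrite !intr_eq0 !denq_neq0.
rewrite pval_frac ?mulf_neq0 ?denq_neq0 ?numq_eq0 // !abszM.
by rewrite !lognM ?absz_gt0 ?denq_neq0 ?numq_eq0 // /pval; lia.
Qed.

Lemma pval_int (k : int) : k != 0 -> pval p k%:~R = (logn p `|k|)%:Z.
Proof. by move=> k0; rewrite -[k%:~R]divr1 (@pval_frac p k 1) // logn1 subr0. Qed.

Lemma pval1 : pval p 1 = 0.
Proof. by have := @pval_int 1 isT; rewrite logn1. Qed.

Lemma pvalX (q : rat) (k : nat) : q != 0 -> pval p (q ^+ k) = k%:Z * pval p q.
Proof.
move=> q0; elim: k => [|k IH]; first by rewrite pval1 mul0r.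
by rewrite exprS pvalM ?expf_neq0 // IH; lia.
Qed.

Lemma pvalV (q : rat) : q != 0 -> pval p q^-1 = - pval p q.
Proof.
move=> q0; have qV0 : q^-1 != 0 by rewrite invr_eq0.
by have := pvalM qV0 q0; rewrite mulVf // pval1 => /esym/eqP; rewrite addr_eq0 => /eqP.
Qed.

Lemma pval_p : pval p p%:R = 1.
Proof. by rewrite pmulrn pval_int ?logn_prime ?eqxx //= -lt0n prime_gt0. Qed.

Lemma pval_ge0 (q : rat) : q != 0 -> (0 <= pval p q) = (q \in inZloc p).
Proof.
move=> q0; rewrite [in RHS]unfold_in /inZloc /pval.
have dgt : (0 < `|denq q|)%N by rewrite absz_gt0 denq_neq0.
rewrite prime_coprime // -[p in (p %| _)%N]expn1 pfactor_dvdn //.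
have [d0|d0] := posnP (logn p `|denq q|); first by rewrite d0; lia.
have pd : (p %| `|denq q|)%N by rewrite -[p]expn1 pfactor_dvdn.
suff : logn p `|numq q| = 0%N by lia.
apply: logn_coprime; rewrite coprime_sym.
exact: coprime_dvdr pd (coprime_num_den q).
Qed.

Lemma Aint_root (n : nat) (x : algC) : (0 < n)%N -> x ^+ n \in Aint -> x \in Aint.
Proof.
move=> n0 xA; apply: (@root_monic_Aint (minCpoly (x ^+ n) \Po 'X^n)).
- by rewrite /root horner_comp hornerXn; apply: root_minCpoly.
- rewrite monicE lead_coef_comp ?size_polyXn // lead_coefXn expr1n mulr1.
  by rewrite -monicE minCpoly_monic.
- by apply: polyOver_comp; [exact: xA | rewrite rpredX ?polyOverX].
Qed.

Lemma plocal_root (n : nat) (x : algC) :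
  (0 < n)%N -> x ^+ n \in plocal p -> x \in plocal p.
Proof.
move=> n0 /plocalP[a pa aA]; apply/plocalP; exists a => //.
apply: (@Aint_root n) => //; rewrite exprMn -(prednK n0) exprS -mulrA mulrCA prednK //.
by apply: rpredM => //; rewrite rpredX ?rpred_nat.
Qed.

(* [prad x] says that [x] lies in the radical of [p] in the ring of elements
   integral over Z_(p): these are the elements of positive valuation. *)
Definition prad (x : algC) : Prop :=
  exists2 k : nat, (0 < k)%N & x ^+ k / p%:R \in plocal p.

Let p_neq0' : (p%:R : algC) != 0.
Proof. by rewrite pnatr_eq0 -lt0n prime_gt0. Qed.

Lemma prad_plocal (x : algC) : prad x -> x \in plocal p.
Proof.
case=> k k0 xk; apply: (plocal_root k0).
by rewrite -(divfK p_neq0' (x ^+ k)) rpredM ?natr_plocal.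
Qed.

Lemma prad1 : ~ prad 1.
Proof.
case=> k _; rewrite expr1n.
have -> : 1 / p%:R = ratr (1%:~R / p%:R) :> algC.
  by rewrite rmorphM fmorphV /= !ratr_nat.
rewrite plocal_ratr inZloc_div // dvdn1.
by rewrite gtn_eqF ?prime_gt1.
Qed.

Lemma pradM (x y : algC) : prad x -> y \in plocal p -> prad (x * y).
Proof.
case=> k k0 xk yp; exists k => //.
by rewrite exprMn mulrAC rpredM ?rpredX.
Qed.

Lemma pradN (x : algC) : prad x -> prad (- x).
Proof. by move=> xr; rewrite -mulrN1; apply: pradM => //; rewrite rpredN rpred1. Qed.

(** In the binomial expansion of (x + y)^(k + l) every term contains x^k or y^l. *)
Lemma pradD (x y : algC) : prad x -> prad y -> prad (x + y).
Proof.
move=> xr yr; have xp := prad_plocal xr; have yp := prad_plocal yr.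
case: xr yr => [k k0 xk] [l l0 yl]; exists (k + l)%N; first by rewrite addn_gt0 k0.
rewrite exprDn mulr_suml; apply: rpred_sum => i _.
rewrite mulrnAl; apply: rpredMn.
have [li|il] := leqP l i.
  have -> : x ^+ (k + l - i) * y ^+ i / p%:R =
      x ^+ (k + l - i) * y ^+ (i - l) * (y ^+ l / p%:R).
    by rewrite -[in y ^+ i](subnK li) exprD !mulrA.
  apply: rpredM; last exact: yl.
  by apply: rpredM; apply: rpredX; [exact: xp | exact: yp].
have -> : x ^+ (k + l - i) * y ^+ i / p%:R =
    x ^+ (l - i) * y ^+ i * (x ^+ k / p%:R).
  have -> : (k + l - i = k + (l - i))%N by lia.
  by rewrite exprD; ring.
apply: rpredM; last exact: xk.
by apply: rpredM; apply: rpredX; [exact: xp | exact: yp].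
Qed.

Lemma prad_sum (I : finType) (P : pred I) (F : I -> algC) :
  (exists i, P i) -> (forall i, P i -> prad (F i)) -> prad (\sum_(i | P i) F i).
Proof.
move=> [i0 Pi0] PF; rewrite (bigD1 i0) //=.
have := PF i0 Pi0; elim/big_rec : _ => [|i x /andP[Pi _] IH x0]; first by rewrite addr0.
by rewrite addrCA; apply: pradD; [apply: PF | apply: IH].
Qed.

Lemma prad_val (n : nat) (x : algC) (q : rat) : (0 < n)%N -> q != 0 ->
  x ^+ n = ratr q -> 0 < pval p q -> prad x.
Proof.
move=> n0 q0 xq qv; exists n => //.
have -> : x ^+ n / p%:R = ratr (q / p%:R).
  by rewrite xq rmorphM fmorphV /= ratr_nat.
rewrite plocal_ratr -pval_ge0 ?mulf_neq0 ?invr_eq0 //.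
by rewrite pvalM ?invr_eq0 // pvalV // pval_p; lia.
Qed.

(** The p-integral elements are integrally closed, so an n-th root of q is p-integral if and only if
    q is. *)
Lemma plocal_val (n : nat) (x : algC) (q : rat) : (0 < n)%N -> q != 0 ->
  x ^+ n = ratr q -> (x \in plocal p) = (0 <= pval p q).
Proof.
move=> n0 q0 xq; rewrite pval_ge0 // -plocal_ratr -xq.
by apply/idP/idP => [|/plocal_root]; [apply: rpredX | apply].
Qed.

(* If some summands were not integral, divide by the one of least valuation:
   this writes [1] as an element of the radical. *)
Lemma plocal_sum_distinct (n : nat) (I : finType) (P : pred I)
    (a : I -> algC) (q : I -> rat) :
  (0 < n)%N -> (forall i, P i -> a i ^+ n = ratr (q i)) ->
  {in P &, forall i j, q i != 0 -> q j != 0 -> pval p (q i) = pval p (q j) -> i = j} ->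
  \sum_(i | P i) a i \in plocal p -> forall i, P i -> a i \in plocal p.
Proof.
move=> n0 aq qinj sA i Pi; apply: contraT => iA.
pose Q := [pred i | P i && (a i \notin plocal p)].
have Qi : Q i by rewrite /= Pi.
have q_neq0 j : Q j -> q j != 0.
  case/andP=> Pj; apply: contraNneq => qj.
  by apply: (plocal_root n0); rewrite aq // qj rmorph0 rpred0.
have a_neq0 j : Q j -> a j != 0.
  by case/andP=> _; apply: contraNneq => ->; rewrite rpred0.
have [k Qk kmin] := arg_minP (fun j => pval p (q j)) Qi.
have [Pk kA] := andP Qk.
have kval : pval p (q k) < 0.
  by rewrite ltNge -(plocal_val n0 (q_neq0 k Qk) (aq k Pk)).
have {}sA : \sum_(j | Q j) a j \in plocal p.
  have : \sum_(j | P j) a j - \sum_(j | P j && (a j \in plocal p)) a j \in plocal p.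
    by apply: rpredB => //; apply: rpred_sum => j /andP[].
  by rewrite (bigID (fun j => a j \in plocal p)) /= addrC addrK.
exfalso; apply: prad1.
have -> : 1 = (a k)^-1 * \sum_(j | Q j) a j + \sum_(j | Q j && (j != k)) - (a j / a k).
  rewrite (bigD1 k) //= mulrDr mulVf ?a_neq0 // sumrN -addrA mulr_sumr.
  by rewrite (eq_bigr (fun j => a j / a k)) ?subrr ?addr0 // => j _; rewrite mulrC.
have ak_rad : prad (a k)^-1.
  apply: (prad_val n0 (q := (q k)^-1)); rewrite ?invr_eq0 ?q_neq0 //.
    by rewrite exprVn aq // fmorphV.
  by rewrite pvalV ?q_neq0 // oppr_gt0.
have sk := pradM ak_rad sA.
have [/existsP ej|] := boolP [exists j, Q j && (j != k)]; last first.
  by rewrite negb_exists => /forallP e0;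
    rewrite [X in _ + X]big_pred0 ?addr0 // => j; apply: negbTE.
apply: pradD => //; apply: prad_sum => // j /andP[Qj jk]; apply: pradN.
have [Pj _] := andP Qj.
apply: (prad_val n0 (q := q j / q k)).
- by rewrite mulf_neq0 ?invr_eq0 ?q_neq0.
- by rewrite expr_div_n !aq // rmorphM fmorphV.
- rewrite pvalM ?invr_eq0 ?q_neq0 // pvalV ?q_neq0 // subr_gt0 lt_neqAle kmin // andbT.
  apply: contraNneq jk => vE; apply/eqP/esym; apply: qinj => //; exact: q_neq0.
Qed.
End Valuation.

Lemma absz_natB (a b : nat) : (b <= a)%N -> `|a%:Z - b%:Z|%N = (a - b)%N.
Proof. lia. Qed.

Lemma dvdn_natB_eq (n a b : nat) :
  (a < n)%N -> (b < n)%N -> (n %| `|(a%:Z - b%:Z)%R|)%N -> a = b.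
Proof.
move=> an bn; case: (posnP `|a%:Z - b%:Z|) => [|D0 /(dvdn_leq D0)]; lia.
Qed.

Section RamifiedCase.
Variables (n p : nat) (m : int) (theta : algC).
Hypotheses (n_gt0 : (0 < n)%N) (m_neq0 : m != 0).
Hypotheses (irr : pure_irr n m) (thetaE : theta ^+ n = m%:~R).
Hypothesis p_pr : prime p.
Let v := logn p `|m|.
Hypothesis pv : ~~ (p %| v)%N.

Let m_neq0' : (m%:~R : rat) != 0.
Proof. by rewrite intr_eq0. Qed.

Lemma monomial_expn (c : rat) (i : nat) :
  (ratr c * theta ^+ i) ^+ n = ratr (c ^+ n * m%:~R ^+ i).
Proof.
by rewrite exprMn -exprM mulnC exprM thetaE rmorphM !rmorphXn /= ratr_int.
Qed.

Lemma monomial_val (c : rat) (i : nat) : c != 0 ->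
  pval p (c ^+ n * m%:~R ^+ i) = n%:Z * pval p c + i%:Z * v%:Z.
Proof. by move=> c0; rewrite pvalM ?expf_neq0 // !pvalX // pval_int. Qed.

(* The p'-part [s] of [n] is invertible, so one may first project onto the
   exponents in a fixed class mod [s]; there [i |-> i v] is injective mod [n]. *)
Lemma ramified_monomial (c : nat -> rat) (i : nat) : (i < n)%N ->
  \sum_(k < n) ratr (c k) * theta ^+ k \in plocal p ->
  ratr (c i) * theta ^+ i \in plocal p.
Proof.
move=> iN cA; pose s := (n`_p^')%N.
have s_n : (s %| n)%N by apply: dvdn_part.
have s0 : (0 < s)%N by apply: part_gt0.
have ps : coprime p s.
  exact: pnat_coprime (pnat_id p_pr) (part_pnat p^' n).
have := plocal_component irr thetaE s_n (ltn_pmod i s0) cA.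
move/(plocal_cancel ps) => {}cA.
apply: (@plocal_sum_distinct p p_pr n 'I_n (fun k => k %% s == i %% s)%N
   (fun k => ratr (c k) * theta ^+ k) (fun k => c k ^+ n * m%:~R ^+ k)
   n_gt0 _ _ cA (Ordinal iN)) => // [k _|j k /eqP js /eqP ks]; first exact: monomial_expn.
rewrite !mulf_eq0 !expf_eq0 !negb_or n_gt0 /= => /andP[cj _] /andP[ck _].
rewrite !monomial_val // => vE; apply: val_inj => /=.
pose D := `|j%:Z - k%:Z|%N.
(* Equality of the valuations n v_p(c) + k v gives n | D v. The p-part of n is prime to v, so it
   divides D; the p'-part s divides D because j and k lie in one class mod s. Hence n | D with D <
   n. *)
have nD : (n %| D * v)%N.
  apply/dvdnP; exists `|pval p (c k) - pval p (c j)|%N.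
  have : (j%:Z - k%:Z) * v%:Z = (pval p (c k) - pval p (c j)) * n%:Z.
    apply: subr0_eq; rewrite -[RHS](subrr (n%:Z * pval p (c j) + j%:Z * v%:Z)).
    by rewrite {2}vE; ring.
  by move/(congr1 absz); rewrite !abszM.
have sD : (s %| D)%N.
  have [kj|/ltnW jk] := leqP k j.
    rewrite /D absz_natB //.
    by rewrite -eqn_mod_dvd // js ks.
  rewrite /D distnC absz_natB //.
  by rewrite -eqn_mod_dvd // js ks.
have pD : (n`_p %| D)%N.
  rewrite -(Gauss_dvdl D (_ : coprime n`_p v)); first exact: dvdn_trans (dvdn_part _ _) nD.
  by rewrite p_part coprimeXl // prime_coprime.
have : (n %| D)%N.
  rewrite -(partnC p n_gt0) Gauss_dvd ?pD //.
  exact: pnat_coprime (part_pnat p n) (part_pnat p^' n).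
by apply: dvdn_natB_eq; apply: ltn_ord.
Qed.

(** Integrality of c_i theta^i reads n v_p(c_i) + i v >= 0, and v_p(c_i) is an integer, so it is at
    least minus the floor of i v / n. *)
Lemma ramified_coef (c : nat -> rat) (i : nat) : (i < n)%N ->
  \sum_(k < n) ratr (c k) * theta ^+ k \in plocal p ->
  c i * p%:R ^+ (i * v %/ n) \in inZloc p.
Proof.
move=> iN /(ramified_monomial iN) cA; have [->|c0] := eqVneq (c i) 0.
  by rewrite mul0r rpred0.
have p0 : (p%:R : rat) != 0 by rewrite pnatr_eq0 -lt0n prime_gt0.
move: cA; rewrite (plocal_val p_pr n_gt0 _ (monomial_expn _ _)) ?mulf_neq0 ?expf_neq0 //.
rewrite monomial_val // -pval_ge0 ?mulf_neq0 ?expf_neq0 //.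
rewrite pvalM ?expf_neq0 // pvalX // pval_p //.
have := divn_eq (i * v) n; have := ltn_pmod (i * v) n_gt0.
move: (i * v %/ n)%N (i * v %% n)%N (pval p (c i)) => f r w rn E.
rewrite -PoszM E PoszD PoszM mulr1 => h.
rewrite leNgt; apply/negP => wf.
have : n%:Z * (w + f%:Z) <= n%:Z * -1 by rewrite ler_pM2l //; lia.
lia.
Qed.

Lemma ramified_int (i : nat) : theta ^+ i / p%:R ^+ (i * v %/ n) \in plocal p.
Proof.
have p0 : (p%:R : rat) != 0 by rewrite pnatr_eq0 -lt0n prime_gt0.
have -> : theta ^+ i / p%:R ^+ (i * v %/ n) = ratr (p%:R ^- (i * v %/ n)) * theta ^+ i.
  by rewrite fmorphV rmorphXn /= ratr_nat mulrC.
rewrite (plocal_val p_pr n_gt0 _ (monomial_expn _ _)); last first.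
  by rewrite mulf_neq0 ?expf_neq0 ?invr_eq0 ?expf_neq0.
rewrite monomial_val ?invr_eq0 ?expf_neq0 // pvalV ?expf_neq0 // pvalX // pval_p //.
have := divn_eq (i * v) n; move: (i * v %/ n)%N (i * v %% n)%N => f r E.
by rewrite -PoszM E; lia.
Qed.
End RamifiedCase.

(** * The twelve-dimensional bases *)

Definition Zspan (p n : nat) (b : nat -> algC) (x : algC) : Prop :=
  exists2 a : nat -> rat, (forall i, a i \in inZloc p) & x = \sum_(i < n) ratr (a i) * b i.

Section Zspan.
Variables (p n : nat) (b : nat -> algC).

Lemma ZspanD (x y : algC) : Zspan p n b x -> Zspan p n b y -> Zspan p n b (x + y).
Proof.
case=> [a aZ ->] [a' aZ' ->]; exists (fun i => a i + a' i).
  by move=> i; apply: rpredD.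
by rewrite -big_split; apply: eq_bigr => i _; rewrite rmorphD /= mulrDl.
Qed.

Lemma Zspan0 : Zspan p n b 0.
Proof.
exists (fun=> 0) => [i|]; first exact: rpred0.
by rewrite big1 // => i _; rewrite rmorph0 mul0r.
Qed.

Lemma Zspan_gen (i : nat) (c : rat) :
  (i < n)%N -> c \in inZloc p -> Zspan p n b (ratr c * b i).
Proof.
move=> ni cZ; exists (fun k => if k == i then c else 0) => [k|].
  by case: eqP => _ //; apply: rpred0.
rewrite (bigD1 (Ordinal ni)) //= eqxx big1 ?addr0 // => k ki.
by rewrite (negPf (ki : val k != i)) rmorph0 mul0r.
Qed.

Lemma Zspan_sum (I : finType) (F : I -> algC) :
  (forall i, Zspan p n b (F i)) -> Zspan p n b (\sum_i F i).
Proof. by move=> FS; elim/big_ind: _ => //; [exact: Zspan0 | exact: ZspanD]. Qed.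
End Zspan.

(** * From a local basis to the index and the p-integral basis of K *)

Section Main.
Variables (m : int) (theta : algC).
Hypotheses (irr : irreducible_poly (fpoly m)) (thetaE : theta ^+ 12 = m%:~R).
Hypothesis m_neq0 : m != 0.

Let theta_int : theta \in Aint.
Proof. exact: theta_Aint thetaE. Qed.

Let theta_free (q : {poly rat}) : (size q <= 12)%N -> ev q theta = 0 -> q = 0.
Proof. exact: (@pure_free 12 m). Qed.

Lemma inKP (x : algC) :
  inK theta x <-> exists2 q : {poly rat}, (size q <= 12)%N & x = ev q theta.
Proof.
split=> [[q ->]|[q _ ->]]; last by exists q.
have f0 : fpoly m != 0 by rewrite -size_poly_eq0 size_XnsubC.
exists (q %% fpoly m).
  by have := ltn_modp q (fpoly m); rewrite f0 size_XnsubC.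
rewrite {1}(divp_eq q (fpoly m)) rmorphD rmorphM hornerD hornerM /= ev_pure.
by rewrite thetaE subrr mulr0 add0r.
Qed.

Lemma inOKP (x : algC) : Aint_below theta 12 x <-> inOK theta x.
Proof.
split=> [[q [qs xE xA]]|[/inKP[q qs xE] xA]]; last by exists q.
by split=> //; exists q.
Qed.

Lemma inZthetaP (x : algC) : Ztheta_below theta 12 x <-> inZtheta theta x.
Proof.
split=> [[q qs ->]|[q ->]]; first by exists q.
pose f : {poly int} := 'X^12 - m%:P.
have f_mon : f \is monic by apply: monicXnsubC.
exists (Pdiv.Ring.rmodp q f).
  by have := Pdiv.Ring.ltn_rmodp q f; rewrite monic_neq0 // size_XnsubC.
rewrite {1}(Pdiv.RingMonic.rdivp_eq f_mon q) rmorphD rmorphM hornerD hornerM /=.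
rewrite [X in _ * X](_ : _ = 0) ?mulr0 ?add0r //.
by rewrite rmorphB /= map_polyXn map_polyC /= !hornerE thetaE subrr.
Qed.

Lemma inRpP (p : nat) (x : algC) : prime p ->
  inRp p theta x <->
  exists q : {poly rat}, [/\ (size q <= 12)%N, x = ev q theta & x \in plocal p].
Proof.
move=> p_pr; split=> [[/inKP[q qs xE] /(integral_plocal _ p_pr) xA]|[q [qs xE xA]]].
  by exists q.
by split; [apply/inKP; exists q | apply/integral_plocal].
Qed.

Let evE (q : {poly rat}) : (size q <= 12)%N ->
  ev q theta = \sum_(i < 12) ratr q`_i * theta ^+ i.
Proof.
move=> qs; rewrite (@horner_coef_wide _ 12) ?size_map_poly //.
by apply: eq_bigr => i _; rewrite coef_map.
Qed.

(** Taking p = 0 in [plocal_coef] yields a global denominator, valid at all primes at once; it is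
    what makes the ideals of leading coefficients fractional. *)
Lemma Aint_denominator (q : {poly rat}) (i : nat) : (size q <= 12)%N ->
  ev q theta \in Aint -> (12 * `|m|)%:R * q`_i \is a Num.int.
Proof.
move=> qs; have [i12|i12] := ltnP i 12; last first.
  by move=> _; rewrite nth_default ?mulr0 ?rpred0 // (leq_trans qs).
rewrite evE // -plocal0 => qA.
have := @plocal_coef 12 m theta isT irr thetaE 0 _ i i12 qA; rewrite plocal0 => cA.
have /intrP[z zA] : (ratr (12%:R * m%:~R * q`_i) : algC) \in Num.int.
  by apply: Cint_rat_Aint => //; apply: Crat_rat.
have zE : 12%:R * m%:~R * q`_i = z%:~R.
  by apply: (fmorph_inj (@ratr algC)); rewrite /= zA ratr_int.
have -> : (12 * `|m|)%:R * q`_i = (sgz m * z)%:~R.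
  rewrite intrM -zE natrM natr_absz normrEsg -sgrz intrM; ring.
exact: rpred_int.
Qed.

Lemma local_basis (p : nat) (beta : nat -> {poly rat}) (e : nat -> nat)
    (b : 'I_12 -> algC) :
  prime p -> (forall i, size (beta i) <= i.+1)%N ->
  (forall i, (beta i)`_i = (p%:R ^+ e i)^-1) ->
  (forall i, (i < 12)%N -> ev (beta i) theta \in plocal p) ->
  (forall c : nat -> rat, \sum_(i < 12) ratr (c i) * theta ^+ i \in plocal p ->
     Zspan p 12 (fun i => ev (beta i) theta) (\sum_(i < 12) ratr (c i) * theta ^+ i)) ->
  (forall i : 'I_12, b i = ev (beta i) theta) ->
  vp_index p theta (\sum_(i < 12) e i) /\ p_integral_basis p theta b.
Proof.
move=> p_pr bs bl bA bspan bE.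
have span (q : {poly rat}) : (size q <= 12)%N -> ev q theta \in plocal p ->
  exists2 a : nat -> rat, (forall i, inZloc p (a i)) &
    ev q theta = \sum_(i < 12) ratr (a i) * ev (beta i) theta.
  by move=> qs; rewrite evE // => /bspan.
split.
  have D_gt0 : (0 < 12 * `|m|)%N by rewrite muln_gt0 absz_gt0.
  have [N [_ NI Np]] := index_below theta_int theta_free D_gt0
    Aint_denominator p_pr bs bl bA span (leqnn 12).
  by exists N; split=> //; exact: is_index_ext inOKP inZthetaP NI.
split=> [i|x /(inRpP _ p_pr)[q [qs xE xA]]|c cZ cs i].
- rewrite bE; apply/(inRpP _ p_pr); exists (beta i); split=> //; last exact: bA.
  exact: leq_trans (bs i) (ltn_ord i).
- rewrite xE in xA; have [a aZ qa] := span q qs xA.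
  exists (fun i => a i); split=> [i|]; first exact: aZ.
  by rewrite xE qa; apply: eq_bigr => i _; rewrite bE.
- have := @comb_free theta 12 p beta e theta_free p_pr bs bl (fun i => c (inord i)).
  have -> : \sum_(i < 12) ratr (c (inord i)) * ev (beta i) theta = 0.
    by rewrite -[RHS]cs; apply: eq_bigr => k _; rewrite inord_val bE.
  by move=> /(_ erefl i (ltn_ord i)); rewrite inord_val.
Qed.
End Main.

Lemma size_addl (R : nzRingType) (q r : {poly R}) (t : nat) :
  (size q <= t)%N -> (size r <= t)%N -> (size (q + r)%R <= t)%N.
Proof. by move=> qt rt; rewrite (leq_trans (size_polyD _ _)) // geq_max qt. Qed.

Section Bases.
Variables (m : int) (theta : algC).
Hypotheses (irr : irreducible_poly (fpoly m)) (thetaE : theta ^+ 12 = m%:~R).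
Hypothesis m_neq0 : m != 0.

Let thetaA : theta \in Aint.
Proof. exact: theta_Aint thetaE. Qed.

Let thetaP (p k : nat) : theta ^+ k \in plocal p.
Proof. by apply: rpredX; apply: Aint_plocal. Qed.

(** All bases of the theorem have this shape: G monic of degree k <= i, shifted by theta^(i - k) and
    divided by p^e. The i-th member then has degree i in theta and leading coefficient 1 / p^e, so
    the family is triangular. *)
Lemma shifted_basis (p : nat) (e k : nat -> nat) (G : nat -> {poly rat})
    (B : nat -> algC) (b : 'I_12 -> algC) :
  prime p -> (forall i, k i <= i)%N -> (forall i, size (G i) <= (k i).+1)%N ->
  (forall i, (G i)`_(k i) = 1) ->
  (forall i, B i = theta ^+ (i - k i) * ev (G i) theta / p%:R ^+ e i) ->
  (forall i, (i < 12)%N -> B i \in plocal p) ->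
  (forall c : nat -> rat, \sum_(i < 12) ratr (c i) * theta ^+ i \in plocal p ->
     Zspan p 12 B (\sum_(i < 12) ratr (c i) * theta ^+ i)) ->
  (forall i : 'I_12, b i = B i) ->
  vp_index p theta (\sum_(i < 12) e i) /\ p_integral_basis p theta b.
Proof.
move=> p_pr ki Gs Gl BE BA Bspan bE.
pose beta i := (p%:R ^+ e i)^-1 *: ('X^(i - k i) * G i).
have betaE i : ev (beta i) theta = B i.
  rewrite map_polyZ rmorphM /= map_polyXn hornerZ !hornerE BE.
  by rewrite fmorphV rmorphXn /= ratr_nat; ring.
apply: (local_basis irr thetaE m_neq0 (beta := beta)) => // [i|i|i i12|c cA|i].
- apply: leq_trans (size_scale_leq _ _) _.
  apply: leq_trans (size_polyMleq _ _) _; rewrite size_polyXn addSn /=.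
  by apply: leq_trans (leq_add (leqnn _) (Gs i)) _; rewrite addnS subnK.
- by rewrite coefZ coefXnM ltnNge leq_subr /= subKn // Gl mulr1.
- by rewrite betaE; apply: BA.
- have -> : (fun i => ev (beta i) theta) = B by apply/funext.
  exact: Bspan.
- by rewrite bE betaE.
Qed.

Lemma monomial_basis (p : nat) (e : nat -> nat) (b : 'I_12 -> algC) :
  prime p ->
  (forall i, theta ^+ i / p%:R ^+ e i \in plocal p) ->
  (forall (c : nat -> rat) (i : nat), (i < 12)%N ->
     \sum_(k < 12) ratr (c k) * theta ^+ k \in plocal p ->
     c i * p%:R ^+ e i \in inZloc p) ->
  (forall i : 'I_12, b i = theta ^+ i / p%:R ^+ e i) ->
  vp_index p theta (\sum_(i < 12) e i) /\ p_integral_basis p theta b.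
Proof.
move=> p_pr eA ec bE.
have p0 : (p%:R : algC) != 0 by rewrite pnatr_eq0 -lt0n prime_gt0.
apply: (@shifted_basis p e (fun=> 0%N) (fun=> 1)
  (fun i => theta ^+ i / p%:R ^+ e i)) => // [i|i|i|c cA].
- by rewrite size_poly1.
- by rewrite coef1.
- by rewrite subn0 rmorph1 hornerE mulr1.
apply: Zspan_sum => i.
have -> : ratr (c i) * theta ^+ i =
    ratr (c i * p%:R ^+ e i) * (theta ^+ i / p%:R ^+ e i).
  by rewrite rmorphM rmorphXn /= ratr_nat; field; rewrite expf_neq0.
by apply: (@Zspan_gen p 12 (fun i => theta ^+ i / p%:R ^+ e i)) => //; apply: ec.
Qed.

Lemma power_basis_integral (p : nat) : prime p ->
  (forall (c : nat -> rat) (i : nat), (i < 12)%N ->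
     \sum_(k < 12) ratr (c k) * theta ^+ k \in plocal p -> c i \in inZloc p) ->
  vp_index p theta 0 /\ p_integral_basis p theta (power_basis theta).
Proof.
move=> p_pr pc; rewrite -[in vp_index _ _ 0](@big1_eq nat 0%N addn 'I_12 (index_enum _) predT).
apply: (@monomial_basis p (fun=> 0%N)) => // [i|c i i12 cA|i].
- by rewrite divr1.
- by rewrite mulr1; apply: pc cA.
- by rewrite divr1.
Qed.

Lemma basis_ramified (p : nat) (v := logn p `|m|) : prime p ->
  twelfth_power_free m -> (p %| `|m|)%N -> ~~ (p %| v)%N ->
  vp_index p theta ((11 * (v - 1) + (gcdn v 12 - 1)) %/ 2) /\
  p_integral_basis p theta (basis_case1 p v theta).
Proof.
move=> p_pr m_free pm pv.
have v_gt0 : (0 < v)%N by rewrite -pfactor_dvdn ?absz_gt0 ?expn1.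
have v_lt : (v < 12)%N.
  by have := m_free p p_pr; rewrite pfactor_dvdn ?absz_gt0 // -ltnNge.
(* This is the count of lattice points under the line of slope v / 12. It is checked for v = 1, ...,
   11, the range left by 12-th power freeness. *)
have -> : ((11 * (v - 1) + (gcdn v 12 - 1)) %/ 2 = \sum_(i < 12) i * v %/ 12)%N.
  rewrite !big_ord_recr big_ord0 /=; move: v v_gt0 v_lt {pv} => v.
  by do 12?[case: v => [//|v]].
apply: (@monomial_basis p (fun i => i * v %/ 12)%N) => // [i|c i i12 cA].
  exact: (ramified_int _ m_neq0 thetaE p_pr).
exact: (ramified_coef _ m_neq0 irr thetaE p_pr pv).
Qed.

Lemma basis_unramified (p : nat) : prime p -> ~~ (p %| 12 * `|m|)%N ->
  vp_index p theta 0 /\ p_integral_basis p theta (power_basis theta).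
Proof.
move=> p_pr pm; apply: power_basis_integral => // c i i12 cA.
apply: (@inZloc_cancel p (12 * m)); first by rewrite abszM prime_coprime.
rewrite intrM -plocal_ratr.
exact: (@plocal_coef 12 m theta isT irr thetaE p c i i12 cA).
Qed.
End Bases.

(** * The primes 2 and 3 when they do not divide m *)

Section WildBases.
Variables (m : int) (theta : algC).
Hypotheses (irr : irreducible_poly (fpoly m)) (thetaE : theta ^+ 12 = m%:~R).
Hypothesis m_neq0 : m != 0.

Let thetaA : theta \in Aint.
Proof. exact: theta_Aint thetaE. Qed.

Let thetaP (p k : nat) : theta ^+ k \in plocal p.
Proof. by apply: rpredX; apply: Aint_plocal. Qed.

Let irr3 : pure_irr 3 m.
Proof. exact: (@pure_irr_dvd 4 3). Qed.

Let irr4 : pure_irr 4 m.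
Proof. exact: (@pure_irr_dvd 3 4). Qed.

Let theta4E : (theta ^+ 4) ^+ 3 = m%:~R.
Proof. by rewrite -exprM. Qed.

Let theta3E : (theta ^+ 3) ^+ 4 = m%:~R.
Proof. by rewrite -exprM. Qed.

(** Both 4 and theta are units at 3, so the projection onto the class of j mod 4 can be divided by 4
    theta^j, which leaves an element of the field of theta^4. *)
Lemma component_mod4 (c : nat -> rat) (j : nat) : (j < 4)%N -> ~~ (3 %| `|m|)%N ->
  \sum_(i < 12) ratr (c i) * theta ^+ i \in plocal 3 ->
  ratr (c j) + ratr (c (j + 4)%N) * theta ^+ 4 + ratr (c (j + 8)%N) * (theta ^+ 4) ^+ 2
    \in plocal 3.
Proof.
move=> j4 m3 cA; have cop : coprime 3 `|m| by rewrite prime_coprime.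
apply: (@pure_unit 12 m theta isT thetaE 3 _ j cop).
apply: (@plocal_cancel 3 4) => //.
have := @plocal_component 12 m theta irr thetaE 3 4 j c isT j4 cA.
rewrite big_mkcond !big_ord_recr big_ord0 /=.
by case: j j4 => [|[|[|[|//]]]] _ /=; rewrite !(addr0, add0r) ?addSn ?add0n;
  congr (_ * _ \in plocal 3); ring.
Qed.

Lemma component_mod3 (c : nat -> rat) (j : nat) : (j < 3)%N -> ~~ (2 %| `|m|)%N ->
  \sum_(i < 12) ratr (c i) * theta ^+ i \in plocal 2 ->
  quartic_val (theta ^+ 3) (c j) (c (j + 3)%N) (c (j + 6)%N) (c (j + 9)%N) \in plocal 2.
Proof.
move=> j3 m2 cA; have cop : coprime 2 `|m| by rewrite prime_coprime.
apply: (@pure_unit 12 m theta isT thetaE 2 _ j cop).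
apply: (@plocal_cancel 2 3) => //.
have := @plocal_component 12 m theta irr thetaE 2 3 j c isT j3 cA.
rewrite big_mkcond !big_ord_recr big_ord0 /= /quartic_val.
by case: j j3 => [|[|[|//]]] _ /=; rewrite !(addr0, add0r) ?addSn ?add0n;
  congr (_ * _ \in plocal 2); ring.
Qed.

Lemma sum12_mod4 (F : nat -> algC) :
  \sum_(i < 12) F i = \sum_(j < 4) (F j + F (j + 4)%N + F (j + 8)%N).
Proof. by rewrite !big_ord_recr !big_ord0 /= !addSn ?add0n; ring. Qed.

Lemma sum12_mod3 (F : nat -> algC) :
  \sum_(i < 12) F i = \sum_(j < 3) (F j + F (j + 3)%N + F (j + 6)%N + F (j + 9)%N).
Proof. by rewrite !big_ord_recr !big_ord0 /= !addSn ?add0n; ring. Qed.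

Lemma basis_3_not9 : ~~ (3 %| `|m|)%N -> ~ (m ^+ 2 = 1 %[mod 9])%Z ->
  vp_index 3 theta 0 /\ p_integral_basis 3 theta (power_basis theta).
Proof.
move=> m3 m9; apply: (power_basis_integral irr thetaE m_neq0) => // c i i12 cA.
have j4 : (i %% 4 < 4)%N by rewrite ltn_pmod.
have [c0 c1 c2] := cubic_coef_not9 irr3 theta4E m3 m9 (component_mod4 j4 m3 cA).
have [|[|]] : (i %% 4 = i \/ i %% 4 + 4 = i \/ i %% 4 + 8 = i)%N by lia.
- by move=> <-.
- by move=> <-.
- by move=> <-.
Qed.

Lemma basis_2_3mod4 : ~~ (2 %| `|m|)%N -> (m = 3 %[mod 4])%Z ->
  vp_index 2 theta 0 /\ p_integral_basis 2 theta (power_basis theta).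
Proof.
move=> m2 m4; apply: (power_basis_integral irr thetaE m_neq0) => // c i i12 cA.
have j3 : (i %% 3 < 3)%N by rewrite ltn_pmod.
have [c0 c1 c2 c3] := quartic_coef3mod4 irr4 theta3E m2 m4 (component_mod3 j3 m2 cA).
have [|[|[|]]] : (i %% 3 = i \/ i %% 3 + 3 = i \/ i %% 3 + 6 = i \/ i %% 3 + 9 = i)%N by lia.
- by move=> <-.
- by move=> <-.
- by move=> <-.
- by move=> <-.
Qed.

Lemma basis_3_9 : ~~ (3 %| `|m|)%N -> (m ^+ 2 = 1 %[mod 9])%Z ->
  vp_index 3 theta 4 /\ p_integral_basis 3 theta (basis_p3 m theta).
Proof.
move=> m3 m9.
pose low i := (i < 8)%N.
pose B i := if low i then theta ^+ i else theta ^+ (i - 8) * h_theta m theta / 3.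
have -> : 4%N = (\sum_(i < 12) if low i then 0 else 1)%N.
  by rewrite !big_ord_recr big_ord0.
apply: (@shifted_basis m theta irr thetaE m_neq0 3 (fun i => if low i then 0 else 1)%N
  (fun i => if low i then 0 else 8)%N
  (fun i => if low i then 1 else 'X^8 + (m%:~R *: 'X^4 + 1)) B) => //.
- by move=> i; rewrite /low; case: ltnP.
- move=> i; case: (low i); rewrite ?size_poly1 //.
  rewrite !size_addl ?size_polyXn ?size_poly1 //.
  by rewrite (leq_trans (size_scale_leq _ _)) ?size_polyXn.
- by move=> i; case: (low i); rewrite ?coef1 // !coefD coefZ !coefXn coef1 /= mulr0 !addr0.
- move=> i; rewrite /B /low; case: ltnP => _; first by rewrite subn0 rmorph1 hornerE mulr1 divr1.
  rewrite !rmorphD /= map_polyZ !map_polyXn rmorph1 -polyC1 !hornerD hornerZ hornerC.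
  by rewrite !hornerXn /= ratr_int /h_theta addrA expr1.
- move=> i _; rewrite /B; case: (low i); first exact: thetaP.
  rewrite -mulrA; apply: rpredM; first exact: thetaP.
  apply: Aint_plocal; have := cubic_h_int theta4E m9.
  by congr (_ \in Aint); rewrite /h_theta -exprM; field.
move=> c cA; rewrite (sum12_mod4 (fun i => ratr (c i) * theta ^+ i)).
apply: Zspan_sum => j.
have [c2Z c0Z c1Z] := cubic_coef irr3 theta4E m3 (component_mod4 (ltn_ord j) m3 cA).
have -> : ratr (c j) * theta ^+ j + ratr (c (j + 4)%N) * theta ^+ (j + 4)
   + ratr (c (j + 8)%N) * theta ^+ (j + 8) =
   ratr (c j - c (j + 8)%N) * B j + ratr (c (j + 4)%N - m%:~R * c (j + 8)%N) * B (j + 4)%N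
   + ratr (3 * c (j + 8)%N) * B (j + 8)%N.
  have [l0 l4 l8] : [/\ low j, low (j + 4)%N & low (j + 8)%N = false].
    by case: (j) => [[|[|[|[|k]]]]].
  rewrite /B l0 l4 l8 addnK /h_theta !exprD !(rmorphM, rmorphB) /= ratr_int ratr_nat.
  by field.
by apply: ZspanD; [apply: ZspanD|]; apply: Zspan_gen => //; case: (j) => [[|[|[|[|k]]]]].
Qed.

Lemma basis_2_1mod8 : ~~ (2 %| `|m|)%N -> (m = 1 %[mod 8])%Z ->
  vp_index 2 theta 9 /\ p_integral_basis 2 theta (basis_p2_1mod8 theta).
Proof.
move=> m2 m8; have m4 : (m = 1 %[mod 4])%Z by lia.
pose low i := (i < 6)%N; pose mid i := (i < 9)%N.
pose B i := if low i then theta ^+ i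
  else if mid i then theta ^+ (i - 6) * (theta ^+ 6 - 1) / 2
  else theta ^+ (i - 9) * g_theta theta / 2 ^+ 2.
have -> : 9%N = (\sum_(i < 12) if low i then 0 else if mid i then 1 else 2)%N.
  by rewrite !big_ord_recr big_ord0.
apply: (@shifted_basis m theta irr thetaE m_neq0 2
  (fun i => if low i then 0 else if mid i then 1 else 2)%N
  (fun i => if low i then 0 else if mid i then 6 else 9)%N
  (fun i => if low i then 1
    else if mid i then 'X^6 - 1 else 'X^9 + ('X^6 + ('X^3 + 1))) B) => //.
- by move=> i; rewrite /low /mid; case: ltnP => // h6; case: ltnP.
- move=> i; case: (low i); rewrite ?size_poly1 //; case: (mid i).
    by rewrite size_subl ?size_polyXn ?size_poly1.
  by rewrite !size_addl ?size_polyXn ?size_poly1.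
- move=> i; case: (low i); rewrite ?coef1 //; case: (mid i).
    by rewrite coefB coefXn coef1 subr0.
  by rewrite !coefD !coefXn coef1 !addr0.
- move=> i; rewrite /B; case: (low i); first by rewrite subn0 rmorph1 hornerE mulr1 divr1.
  case: (mid i).
    by rewrite rmorphB /= map_polyXn rmorph1 -polyC1 hornerD hornerN hornerC hornerXn expr1.
  rewrite !rmorphD /= !map_polyXn rmorph1 -polyC1 !hornerD hornerC !hornerXn.
  by rewrite /g_theta !addrA.
- move=> i _; rewrite /B; case: (low i); first exact: thetaP.
  case: (mid i); rewrite -mulrA; apply: rpredM; try exact: thetaP; apply: Aint_plocal.
    have := quartic_w_int theta3E m4.
    by congr (_ \in Aint); rewrite -exprM.
  have := quartic_g_int theta3E m8.
  by congr (_ \in Aint); rewrite /g_theta -!exprM; field.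
move=> c cA; rewrite (sum12_mod3 (fun i => ratr (c i) * theta ^+ i)).
apply: Zspan_sum => j.
have [c3Z c2Z c1Z c0Z] :=
  quartic_coef1mod8 irr4 theta3E m2 m8 (component_mod3 (ltn_ord j) m2 cA).
(* These are the coordinates given by [quartic_coef1mod8] for u = theta^3, the four basis elements
   being multiplied by theta^j. *)
have -> : ratr (c j) * theta ^+ j + ratr (c (j + 3)%N) * theta ^+ (j + 3)
   + ratr (c (j + 6)%N) * theta ^+ (j + 6) + ratr (c (j + 9)%N) * theta ^+ (j + 9) =
   ratr (c j + c (j + 6)%N - 2 * c (j + 9)%N) * B j
   + ratr (c (j + 3)%N - c (j + 9)%N) * B (j + 3)%N
   + ratr (2 * (c (j + 6)%N - c (j + 9)%N)) * B (j + 6)%N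
   + ratr (4 * c (j + 9)%N) * B (j + 9)%N.
  have [l0 l3 [l6 d6] [l9 d9]] : [/\ low j, low (j + 3)%N,
      low (j + 6)%N = false /\ mid (j + 6)%N & low (j + 9)%N = false /\ mid (j + 9)%N = false].
    by case: (j) => [[|[|[|k]]]].
  rewrite /B l0 l3 l6 d6 l9 d9 !addnK /g_theta !exprD.
  rewrite !(rmorphM, rmorphB) /= !(rmorphM, rmorphD, rmorphB) /=
      ?(ratr_nat _ 2) ?(ratr_nat _ 4) ?rmorph1.
  by field.
by apply: ZspanD; [apply: ZspanD; [apply: ZspanD|]|]; apply: Zspan_gen => //;
  case: (j) => [[|[|[|k]]]].
Qed.

Lemma basis_2_5mod8 : ~~ (2 %| `|m|)%N -> (m = 5 %[mod 8])%Z ->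
  vp_index 2 theta 6 /\ p_integral_basis 2 theta (basis_p2_5mod8 theta).
Proof.
move=> m2 m8; have m4 : (m = 1 %[mod 4])%Z by lia.
pose low i := (i < 6)%N.
pose B i := if low i then theta ^+ i else theta ^+ (i - 6) * (theta ^+ 6 - 1) / 2.
have -> : 6%N = (\sum_(i < 12) if low i then 0 else 1)%N.
  by rewrite !big_ord_recr big_ord0.
apply: (@shifted_basis m theta irr thetaE m_neq0 2 (fun i => if low i then 0 else 1)%N
  (fun i => if low i then 0 else 6)%N (fun i => if low i then 1 else 'X^6 - 1) B) => //.
- by move=> i; rewrite /low; case: ltnP.
- move=> i; case: (low i); rewrite ?size_poly1 //.
  by rewrite size_subl ?size_polyXn ?size_poly1.
- by move=> i; case: (low i); rewrite ?coef1 // coefB coefXn coef1 subr0.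
- move=> i; rewrite /B; case: (low i); first by rewrite subn0 rmorph1 hornerE mulr1 divr1.
  by rewrite rmorphB /= map_polyXn rmorph1 -polyC1 hornerD hornerN hornerC hornerXn expr1.
- move=> i _; rewrite /B; case: (low i); first exact: thetaP.
  rewrite -mulrA; apply: rpredM; first exact: thetaP.
  apply: Aint_plocal; have := quartic_w_int theta3E m4.
  by congr (_ \in Aint); rewrite -exprM.
move=> c cA; rewrite (sum12_mod3 (fun i => ratr (c i) * theta ^+ i)).
apply: Zspan_sum => j.
have [c2Z c3Z c0Z c1Z] :=
  quartic_coef5mod8 irr4 theta3E m2 m8 (component_mod3 (ltn_ord j) m2 cA).
(* Exponents are paired at distance 6: a theta^i + b theta^(i + 6) = (a + b) theta^i + 2 b theta^i
   (theta^6 - 1) / 2, for i = j and i = j + 3. *)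
have -> : ratr (c j) * theta ^+ j + ratr (c (j + 3)%N) * theta ^+ (j + 3)
   + ratr (c (j + 6)%N) * theta ^+ (j + 6) + ratr (c (j + 9)%N) * theta ^+ (j + 9) =
   ratr (c j + c (j + 6)%N) * B j
   + ratr (c (j + 3)%N + c (j + 9)%N) * B (j + 3)%N
   + ratr (2 * c (j + 6)%N) * B (j + 6)%N
   + ratr (2 * c (j + 9)%N) * B (j + 9)%N.
  have [l0 l3 l6 l9] : [/\ low j, low (j + 3)%N, low (j + 6)%N = false &
      low (j + 9)%N = false].
    by case: (j) => [[|[|[|k]]]].
  have j9 : (j + 9 - 6 = j + 3)%N by rewrite -addnBA.
  rewrite /B l0 l3 l6 l9 addnK j9 !exprD.
  rewrite !(rmorphM, rmorphD) /= ?(ratr_nat _ 2) ?rmorph1.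
  by field.
by apply: ZspanD; [apply: ZspanD; [apply: ZspanD|]|]; apply: Zspan_gen => //;
  case: (j) => [[|[|[|k]]]].
Qed.
End WildBases.

Theorem theorem2p2 (m : int) (theta : algC) (p : nat) :
  twelfth_power_free m ->
  irreducible_poly (fpoly m) ->
  theta ^+ 12 = m%:~R ->
  prime p ->
  let v := logn p `|m| in
  let d := gcdn v 12 in
  [/\ ((p %| `|m|)%N -> ~~ (p %| v)%N ->
         vp_index p theta ((11 * (v - 1) + (d - 1)) %/ 2) /\
         p_integral_basis p theta (basis_case1 p v theta)),
      (p = 3%N -> ~~ (3 %| `|m|)%N ->
         if (m ^+ 2 == 1 %[mod 9])%Z
         then vp_index 3 theta 4 /\ p_integral_basis 3 theta (basis_p3 m theta)
         else vp_index 3 theta 0 /\ p_integral_basis 3 theta (power_basis theta)),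
      (p = 2%N -> ~~ (2 %| `|m|)%N ->
         [/\ (m == 1 %[mod 8])%Z ->
               vp_index 2 theta 9 /\ p_integral_basis 2 theta (basis_p2_1mod8 theta),
             (m == 5 %[mod 8])%Z ->
               vp_index 2 theta 6 /\ p_integral_basis 2 theta (basis_p2_5mod8 theta) &
             (m == 3 %[mod 4])%Z ->
               vp_index 2 theta 0 /\ p_integral_basis 2 theta (power_basis theta)]) &
      (~~ (p %| 12 * `|m|)%N ->
         vp_index p theta 0 /\ p_integral_basis p theta (power_basis theta))].
Proof.
move=> m_free irr thetaE p_pr v d.
have m_neq0 : m != 0 by apply: contraNneq (m_free p p_pr) => ->; rewrite dvdn0.
split=> [||_|].
- exact: (basis_ramified irr thetaE m_neq0 p_pr m_free).
- move=> _ m3; case: eqP => m9; first exact: (basis_3_9 irr thetaE m_neq0 m3 m9).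
  exact: (basis_3_not9 irr thetaE m_neq0 m3 m9).
- move=> m2; split=> /eqP m8.
  + exact: (basis_2_1mod8 irr thetaE m_neq0 m2 m8).
  + exact: (basis_2_5mod8 irr thetaE m_neq0 m2 m8).
  + exact: (basis_2_3mod4 irr thetaE m_neq0 m2 m8).
- exact: (basis_unramified irr thetaE m_neq0 p_pr).
Qed.
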